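(* Let $p,q\ge1$, $M=p+q$, let $c=(c_h)_{h\in\mathbb Z}$ be a scalar sequence with $c_h=0$ for $h<p$, and let $\mathcal L=\mathcal S^q+c\,\mathcal S^{-p}$. For every $\ell\ge1$, the equation \[ \frac{\partial\mathcal L}{\partial t_\ell}=\bigl[(\mathcal L^{M\ell})_+,\mathcal L\bigr] \] defines a formal flow that preserves the two exponents $q$ and $-p$, and these formal flows commute. On the Banach space \[ \mathcal X_\infty=\{c\in\ell^\infty(\mathbb N_0;\mathbb C):c_h=0\text{ for }0\le h<p\}, \] with each sequence extended by zero to negative indices, the right-hand side is locally Lipschitz; hence, for bounded initial data, each equation defines a unique local $C^1$ flow. If \[ \varrho_h^{(\ell)}=\bigl(\operatorname{res}_{\mathcal S}\mathcal L^{M\ell}\bigr)_h , \] then \[ \frac{\partial c_h}{\partial t_\ell}=c_h\bigl(\varrho_h^{(\ell)}-\varrho_{h-p}^{(\ell)}\bigr). \] Consequently, the boundary values $c_h=0$, $h<p$, remain zero. Along every real solution, strict positivity of the remaining coefficients ($c_h$, $h\ge p$) is preserved throughout its interval of existence.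
   Context: $\mathcal S$ is the forward shift on scalar sequences, $(\mathcal Sf)_h=f_{h+1}$. Difference operators are finite sums $\sum_jf^{(j)}\mathcal S^j$ with scalar-sequence coefficients, multiplied according to $\mathcal S^jc=c_{\,\cdot+j}\mathcal S^j$. For a difference operator $X$, $X_+$ is the sum of its terms with nonnegative powers of $\mathcal S$, and $\operatorname{res}_{\mathcal S}X=[\mathcal S^0]X$ is the coefficient (a sequence) of $\mathcal S^0$. $[X,Y]=XY-YX$. No coprimality of $p$ and $q$ is assumed. *)

(* Defs.v *)
From HB Require Import structures.
From mathcomp Require Import all_boot all_order all_algebra.
(* monalg must come before all_analysis: in the other order some notation
   levels clash. *)
From mathcomp Require Import finmap.
From mathcomp Require Import monalg.
From mathcomp Require Import all_classical all_reals all_analysis.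
From mathcomp Require Import complex ring.

Set Implicit Arguments.
Unset Strict Implicit.
Unset Printing Implicit Defensive.
Import Order.TTheory GRing.Theory Num.Theory.
Import numFieldNormedType.Exports.
Local Open Scope classical_set_scope.
Local Open Scope ring_scope.

(* A finite sum \sum_j f^(j) S^j is an element of {malg (int -> A)[int]}: the
   coefficient sequence f^(j) is X@_j and << f *g j >> is the monomial f S^j.
   The copy below carries the product twisted by S^j c = c_(. + j) S^j. *)
Definition diffop (A : comNzRingType) : Type := {malg (int -> A)[int]}.

Section DiffOp.
Variable A : comNzRingType.
Implicit Types (X Y Z : diffop A) (f g : int -> A) (i j k : int).

HB.instance Definition _ := GRing.Zmodule.on (diffop A).

Definition shift j f : int -> A := fun h => f (h + j).

Definition dmon f j : diffop A := << f *g j >>.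

Definition dcoef j X : int -> A := X@_j.

Definition dmul X Y : diffop A :=
  \sum_(i <- msupp X) \sum_(j <- msupp Y)
    dmon (dcoef i X * shift i (dcoef j Y)) (i + j).

Lemma dmon0 j : dmon 0 j = 0.
Proof. exact: monalgU0. Qed.

Lemma dmonD j : {morph dmon^~ j : f g / f + g}.
Proof. exact: monalgUD. Qed.

Lemma dcoef_dmon i f j : dcoef j (dmon f i) = f *+ (i == j).
Proof. exact: mcoeffU. Qed.

Lemma shift0r f : shift 0 f = f.
Proof. by apply/funext => h; rewrite /shift addr0. Qed.

Lemma shiftD j f g : shift j (f + g) = shift j f + shift j g.
Proof. by []. Qed.

Lemma shiftM j f g : shift j (f * g) = shift j f * shift j g.
Proof. by []. Qed.

Lemma shift0 j : shift j 0 = 0.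
Proof. by []. Qed.

Lemma shift1 j : shift j 1 = 1.
Proof. by []. Qed.

Lemma shift_shift i j f : shift i (shift j f) = shift (i + j) f.
Proof. by apply/funext => h; rewrite /shift -addrA. Qed.

Lemma diffopE X : X = \sum_(i <- msupp X) dmon (dcoef i X) i.
Proof. exact: monalgE. Qed.

Lemma dmulEw X Y (d1 d2 : {fset int}) :
  (msupp X `<=` d1)%fset -> (msupp Y `<=` d2)%fset ->
  dmul X Y = \sum_(i <- d1) \sum_(j <- d2)
    dmon (dcoef i X * shift i (dcoef j Y)) (i + j).
Proof.
move=> s1 s2; rewrite /dmul.
rewrite (big_fset_incl _ s1) /=; last first.
  move=> i _ iX; rewrite big1 // => j _.
  by rewrite /dcoef (mcoeff_outdom iX) mul0r dmon0.
apply: eq_bigr => i _; rewrite (big_fset_incl _ s2) //= => j _ jY.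
by rewrite /dcoef (mcoeff_outdom jY) shift0 mulr0 dmon0.
Qed.

Lemma dmulDl : left_distributive dmul +%R.
Proof.
move=> X Y Z.
have sX : (msupp X `<=` msupp X `|` msupp Y)%fset by exact: fsubsetUl.
have sY : (msupp Y `<=` msupp X `|` msupp Y)%fset by exact: fsubsetUr.
rewrite (dmulEw (msuppD_le X Y) (fsubset_refl (msupp Z))).
rewrite (dmulEw sX (fsubset_refl (msupp Z))).
rewrite (dmulEw sY (fsubset_refl (msupp Z))) -big_split /=.
apply: eq_bigr => i _; rewrite -big_split /=; apply: eq_bigr => j _.
by rewrite /dcoef mcoeffD mulrDl dmonD.
Qed.

Lemma dmulDr : right_distributive dmul +%R.
Proof.
move=> X Y Z.
have sX : (msupp Y `<=` msupp Y `|` msupp Z)%fset by exact: fsubsetUl.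
have sY : (msupp Z `<=` msupp Y `|` msupp Z)%fset by exact: fsubsetUr.
rewrite (dmulEw (fsubset_refl (msupp X)) (msuppD_le Y Z)).
rewrite (dmulEw (fsubset_refl (msupp X)) sX).
rewrite (dmulEw (fsubset_refl (msupp X)) sY) -big_split /=.
apply: eq_bigr => i _; rewrite -big_split /=; apply: eq_bigr => j _.
by rewrite /dcoef mcoeffD shiftD mulrDr dmonD.
Qed.

Lemma dmul0l Y : dmul 0 Y = 0.
Proof. by rewrite /dmul msupp0 big_seq_fset0. Qed.

Lemma dmul0r X : dmul X 0 = 0.
Proof. by rewrite /dmul big1 // => i _; rewrite msupp0 big_seq_fset0. Qed.

Lemma dmul_suml (I : Type) (r : seq I) (F : I -> diffop A) Y :
  dmul (\sum_(i <- r) F i) Y = \sum_(i <- r) dmul (F i) Y.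
Proof.
elim: r => [|x r IH]; first by rewrite !big_nil dmul0l.
by rewrite !big_cons dmulDl IH.
Qed.

Lemma dmul_sumr (I : Type) (r : seq I) (F : I -> diffop A) X :
  dmul X (\sum_(i <- r) F i) = \sum_(i <- r) dmul X (F i).
Proof.
elim: r => [|x r IH]; first by rewrite !big_nil dmul0r.
by rewrite !big_cons dmulDr IH.
Qed.

Lemma dmul_dmon f i g j :
  dmul (dmon f i) (dmon g j) = dmon (f * shift i g) (i + j).
Proof.
rewrite (dmulEw (d1 := [fset i]%fset) (d2 := [fset j]%fset)) ?msuppU_le //.
by rewrite !big_seq_fset1 !dcoef_dmon !eqxx !mulr1n.
Qed.

Lemma dmulA : associative dmul.
Proof.
move=> X Y Z; rewrite (diffopE X) !dmul_suml; apply: eq_bigr => i _.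
rewrite (diffopE Y) !(dmul_suml, dmul_sumr); apply: eq_bigr => j _.
rewrite (diffopE Z) !dmul_sumr; apply: eq_bigr => k _.
by rewrite !dmul_dmon shiftM shift_shift mulrA addrA.
Qed.

Lemma dmul1l : left_id (dmon 1 0) dmul.
Proof.
move=> X; rewrite [X in LHS]diffopE [RHS]diffopE dmul_sumr.
by apply: eq_bigr => i _; rewrite dmul_dmon mul1r add0r shift0r.
Qed.

Lemma dmul1r : right_id (dmon 1 0) dmul.
Proof.
move=> X; rewrite [X in LHS]diffopE [RHS]diffopE dmul_suml.
by apply: eq_bigr => i _; rewrite dmul_dmon shift1 mulr1 addr0.
Qed.

HB.instance Definition _ := GRing.Zmodule_isPzRing.Build (diffop A)
  dmulA dmul1l dmul1r dmulDl dmulDr.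

Definition pos_part X : diffop A :=
  \sum_(j <- msupp X | (0 <= j)%R) dmon (dcoef j X) j.

Definition res X : int -> A := dcoef 0 X.

Definition commutator X Y : diffop A := X * Y - Y * X.

Definition Lop (p q : nat) (c : int -> A) : diffop A :=
  dmon 1 q%:Z + dmon c (- p%:Z).

Definition lax_rhs (p q l : nat) (c : int -> A) : diffop A :=
  commutator (pos_part (Lop p q c ^+ ((p + q) * l))) (Lop p q c).

Definition varrho (p q l : nat) (c : int -> A) : int -> A :=
  res (Lop p q c ^+ ((p + q) * l)).

End DiffOp.

(* [Rcomplex R] is the type R[i] with its R-vector space structure and its
   R-valued modulus; it only lacks the normedModType structure. *)
Section RcomplexNormed.
Variable R : realType.

Lemma Rcomplex_normZ (a : R) (x : Rcomplex R) : `|a *: x| = `|a| * `|x|.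
Proof.
have E (u v : R) : `|Complex u v : Rcomplex R| = Num.sqrt (u ^+ 2 + v ^+ 2).
  by [].
case: x => x y.
have -> : a *: (Complex x y : Rcomplex R) = Complex (a * x) (a * y) by [].
rewrite !E.
by rewrite !exprMn -mulrDr sqrtrM ?sqr_ge0 // sqrtr_sqr.
Qed.

HB.instance Definition _ :=
  PseudoMetric.copy (Rcomplex R) (pseudoMetric_normed (Rcomplex R)).
HB.instance Definition _ := isPointed.Build (Rcomplex R) 0.
HB.instance Definition _ :=
  NormedZmod_PseudoMetric_eq.Build R (Rcomplex R) erefl.
HB.instance Definition _ :=
  PseudoMetricNormedZmod_Lmodule_isNormedModule.Build R (Rcomplex R)
    Rcomplex_normZ.

End RcomplexNormed.

Section Xinf.
Variables (R : realType) (p : nat).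

Definition Xinf_set : {pred nat -> Rcomplex R} :=
  fun c => `[< bounded_fun c /\ (forall h, (h < p)%N -> c h = 0) >].

Record Xinf := MkXinf { xval :> nat -> Rcomplex R ; _ : xval \in Xinf_set }.

HB.instance Definition _ := [isSub for xval].
HB.instance Definition _ := [Choice of Xinf by <:].

Lemma bounded_seqP (c : nat -> Rcomplex R) :
  bounded_fun c <-> exists M : R, forall h, `|c h| <= M.
Proof.
have PF : ProperFilter (globally [set: nat]).
  exact: (@globally_properfilter _ _ 0%N).
split=> [/(@ex_bound _ _ _ _ _ PF)[M Mc]|[M Mc]].
  by exists M => h; exact: Mc.
by apply/(@ex_bound _ _ _ _ _ PF); exists M => h _; exact: Mc.
Qed.

Lemma Xinf_submod_closed : submod_closed Xinf_set.
Proof.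
split=> [|a u v].
  by apply/asboolP; split=> //; apply/bounded_seqP; exists 0 => h; rewrite normr0.
move=> /asboolP[/bounded_seqP[M Mu] u0] /asboolP[/bounded_seqP[N Nv] v0].
apply/asboolP; split=> [|h hp]; last first.
  have -> : (a *: u + v) h = a *: u h + v h by [].
  by rewrite u0 // v0 // scaler0 addr0.
apply/bounded_seqP; exists (`|a| * M + N) => h.
rewrite (le_trans (ler_normD _ _)) // lerD // normrZ.
by rewrite ler_wpM2l.
Qed.

HB.instance Definition _ := GRing.isSubmodClosed.Build R (nat -> Rcomplex R)
  Xinf_set Xinf_submod_closed.
HB.instance Definition _ := [SubChoice_isSubLmodule of Xinf by <:].

Definition supnorm (u : Xinf) : R := sup (range (fun h => `|u h|)).

Lemma supnorm_has_sup (u : Xinf) : has_sup (range (fun h => `|u h|)).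
Proof.
split; first by exists `|u 0%N|, 0%N.
have /asboolP[/bounded_seqP[M Mu] _] := valP u.
by exists M => _ [h _ <-].
Qed.

Lemma supnorm_ge (u : Xinf) h : `|u h| <= supnorm u.
Proof. by apply: sup_upper_bound; [exact: supnorm_has_sup|exists h]. Qed.

Lemma supnorm_le (u : Xinf) M : (forall h, `|u h| <= M) -> supnorm u <= M.
Proof.
move=> uM; apply: ge_sup; first by have [] := supnorm_has_sup u.
by move=> _ [h _ <-].
Qed.

Lemma supnormD u v : supnorm (u + v) <= supnorm u + supnorm v.
Proof.
apply: supnorm_le => h; rewrite (le_trans (ler_normD _ _)) //.
by rewrite lerD // supnorm_ge.
Qed.

Lemma supnormZ (a : R) u : supnorm (a *: u) = `|a| * supnorm u.
Proof.
have le (b : R) v : supnorm (b *: v) <= `|b| * supnorm v.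
  by apply: supnorm_le => h; rewrite normrZ ler_wpM2l // supnorm_ge.
apply/eqP; rewrite eq_le le /=.
have [->|a0] := eqVneq a 0.
  by rewrite normr0 mul0r (le_trans _ (supnorm_ge _ 0%N)).
rewrite mulrC -ler_pdivlMr ?normr_gt0 // mulrC -normfV.
by rewrite -{1}(scalerK a0 u) le.
Qed.

Lemma supnorm0_eq0 u : supnorm u = 0 -> u = 0.
Proof.
move=> u0; apply/val_inj/funext => h; apply/eqP.
by rewrite -normr_le0 -u0 supnorm_ge.
Qed.

HB.instance Definition _ := Lmodule_isNormed.Build R Xinf
  supnormD supnormZ supnorm0_eq0.

Lemma Re_le_norm (z : Rcomplex R) : `|complex.Re z| <= `|z|.
Proof.
case: z => x y; rewrite [leRHS]/(Num.sqrt (x ^+ 2 + y ^+ 2)) -sqrtr_sqr.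
by rewrite ler_wsqrtr // lerDl sqr_ge0.
Qed.

Lemma Im_le_norm (z : Rcomplex R) : `|complex.Im z| <= `|z|.
Proof.
case: z => x y; rewrite [leRHS]/(Num.sqrt (x ^+ 2 + y ^+ 2)) -sqrtr_sqr.
by rewrite ler_wsqrtr // lerDr sqr_ge0.
Qed.

Lemma norm_le_ReIm (z : Rcomplex R) :
  `|z| <= `|complex.Re z| + `|complex.Im z|.
Proof.
case: z => x y; rewrite [leLHS]/(Num.sqrt (x ^+ 2 + y ^+ 2)) /=.
rewrite -[leRHS]ger0_norm ?addr_ge0 // -sqrtr_sqr ler_wsqrtr //.
by rewrite sqrrD !real_normK ?num_real // addrAC lerDl mulrn_wge0 // mulr_ge0.
Qed.

Lemma Xinf_complete (F : set_system Xinf) : ProperFilter F -> cauchy F -> cvg F.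
Proof.
move=> FF /cauchyP Fc.
have coord (f : Xinf -> R) : (forall u v, `|f u - f v| <= `|u - v|) ->
    exists a, forall (x : Xinf) e, F (ball x e) -> `|f x - a| <= e.
  move=> fl.
  have /cvg_ex[a /cvgrPdist_le fa] : cvg (f @ F).
    apply: R_complete; apply: cauchy_exP => e /Fc[x xe]; exists (f x).
    suff : F (f @^-1` ball (f x) e) by [].
    apply: filterS xe => u; rewrite /preimage /= -!ball_normE /=.
    by move=> xu; exact: le_lt_trans (fl _ _) xu.
  exists a => x e xe; apply/ler_addgt0Pr => d d0.
  have [u [/= xu ua]] := filter_ex (filterI xe (fa d d0)).
  rewrite (le_trans (ler_distD (f u) _ _)) // lerD // 1?distrC //.
  by rewrite distrC (le_trans (fl _ _)) // ltW // -/(ball_ _ _ _ _) ball_normE.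
have reP h : exists a, forall (x : Xinf) e, F (ball x e) ->
    `|complex.Re (x h) - a| <= e.
  apply: (coord (fun x => complex.Re (x h))) => u v.
  by rewrite -raddfB (le_trans (Re_le_norm _)) // (supnorm_ge (u - v)).
have imP h : exists a, forall (x : Xinf) e, F (ball x e) ->
    `|complex.Im (x h) - a| <= e.
  apply: (coord (fun x => complex.Im (x h))) => u v.
  by rewrite -raddfB (le_trans (Im_le_norm _)) // (supnorm_ge (u - v)).
have [a aP] := choice reP; have [b bP] := choice imP.
pose w h : Rcomplex R := Complex (a h) (b h).
have wP (x : Xinf) e h : F (ball x e) -> `|x h - w h| <= e + e.
  move=> xe; rewrite (le_trans (norm_le_ReIm _)) //.
  by rewrite !raddfB lerD // ?aP ?bP.
have wX : w \in Xinf_set.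
  apply/asboolP; split.
    have [x x1] := Fc 1 ltr01; apply/bounded_seqP; exists (1 + 1 + `|x|) => h.
    rewrite -[w h](subrK (x h)) (le_trans (ler_normD _ _)) // lerD //.
      by rewrite distrC wP.
    exact: supnorm_ge.
  move=> h hp; apply/eqP; rewrite -normr_le0; apply/ler_addgt0Pr => e e0.
  rewrite add0r; have /Fc[x xe] : 0 < e / 2 by rewrite divr_gt0.
  have /asboolP[_ x0] := valP x.
  by have := wP x (e / 2) h xe; rewrite -splitr x0 // sub0r normrN.
apply/cvg_ex; exists (MkXinf wX); apply/cvgrPdist_le => e e0.
have /Fc[x xe] : 0 < e / 3 by rewrite divr_gt0.
apply: filterS (xe) => u; rewrite -ball_normE /= => xu.
rewrite (le_trans (ler_distD x _ _)) //.
have -> : e = (e / 3 + e / 3) + e / 3 by field.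
apply: lerD; last exact: ltW.
by apply: supnorm_le => h; rewrite -normrN opprB wP.
Qed.

HB.instance Definition _ := Uniform_isComplete.Build Xinf Xinf_complete.

End Xinf.

Section Flows.
Variable R : realType.

Definition zext (p : nat) (u : Xinf R p) : int -> Rcomplex R :=
  fun h => if h is Posz n then u n else 0.

(* Polynomials over the complex numbers in the unknowns c_p, c_(p+1), ... :
   the k-th indeterminate stands for c_(p+k). *)
Definition cpoly : comNzRingType := {malg (Rcomplex R)[{cmonom nat}]}.

Definition cvar (p : nat) : int -> cpoly :=
  fun h => if h is Posz n then if (n < p)%N then 0 else << ucm (n - p)%N >>
           else 0.

Definition cconst (a : Rcomplex R) : cpoly := a%:MP.

Definition derivation (D : cpoly -> cpoly) : Prop :=
  [/\ forall a, D (cconst a) = 0, {morph D : f g / f + g}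
    & forall f g, D (f * g) = D f * g + f * D g].

(* d/dt_l acts on the algebra of the unknowns as a derivation, and on difference
   operators coefficient by coefficient. *)
Definition formal_flow (p q l : nat) (D : cpoly -> cpoly) : Prop :=
  derivation D /\
  forall j h, D (dcoef j (Lop p q (cvar p)) h) =
              dcoef j (lax_rhs p q l (cvar p)) h.

Definition lax_solution (p q l : nat) (I : set R)
    (c : R -> int -> Rcomplex R) : Prop :=
  forall t, I t -> forall j h,
    is_derive t 1 (fun s => dcoef j (Lop p q (c s)) h)
                  (dcoef j (lax_rhs p q l (c t)) h).

Section Ode.
Variables (V : normedModType R) (F : V -> V).

Definition locally_lipschitz : Prop :=
  forall u, exists2 r : R, 0 < r & [lipschitz F v | v in ball u r].

Definition ode_solution (I : set R) (u : R -> V) : Prop :=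
  forall t, I t -> is_derive t 1 u (F (u t)).

Definition C1_on (I : set R) (u : R -> V) : Prop :=
  forall t, I t -> derivable u t 1 /\ {for t, continuous (derive1 u)}.

(* Phi is a local flow on the box ]-T, T[ x B(u0, r), and it is the only one:
   a differentiable solution on any open interval around 0 agrees with it. *)
Definition unique_local_C1_flow (u0 : V) (r T : R) (Phi : R -> V -> V) : Prop :=
  [/\ forall u, ball u0 r u ->
        [/\ Phi 0 u = u, ode_solution `]- T, T[%classic (Phi^~ u)
          & C1_on `]- T, T[%classic (Phi^~ u)],
      forall t u, t \in `]- T, T[ -> ball u0 r u ->
        {for (t, u), continuous (fun z : R * V => Phi z.1 z.2)},
      forall s t u, s \in `]- T, T[ -> t \in `]- T, T[ ->
        s + t \in `]- T, T[ -> ball u0 r u -> ball u0 r (Phi t u) ->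
        Phi s (Phi t u) = Phi (s + t) u
    & forall u (a b : R) (v : R -> V), ball u0 r u -> a < 0 -> 0 < b ->
        ode_solution `]a, b[%classic v -> v 0 = u ->
        forall t, t \in `]a, b[ -> t \in `]- T, T[ -> v t = Phi t u].

End Ode.
End Flows.

(* Main.v *)
Require Import Defs.
From HB Require Import structures.
From mathcomp Require Import all_boot all_order all_algebra.
From mathcomp Require Import finmap.
From mathcomp Require Import monalg.
From mathcomp Require Import all_classical all_reals all_analysis.
From mathcomp Require Import complex.
From mathcomp Require Import zify ring lra.

Import Order.TTheory GRing.Theory Num.Theory.
Import numFieldNormedType.Exports.
Local Open Scope classical_set_scope.
Local Open Scope ring_scope.

Set Implicit Arguments.
Unset Strict Implicit.
Unset Printing Implicit Defensive.

(** Everything rests on the form of the bracket.  Let M = p + q and P = L^(M l).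
    Since P commutes with L, [P_+, L] = - [P - P_+, L]; since the powers of the
    shift in P are multiples of M, the left-hand side has powers >= -p and the
    right-hand side powers <= q - M = -p.  Only S^(-p) is left, with coefficient
    c_h (rho_h - rho_(h-p)), where rho = res P ([lax_rhsE]).  The factor c_h is
    what preserves the boundary values and the signs.

    Formal flows.  A derivation of the polynomial algebra is determined by its
    values on the unknowns, which can be prescribed freely ([derivation_ext],
    [exists_derivation]); the Lax equation prescribes them.  The bracket of two
    flows is again a derivation, so that commutation is the equality of the two
    second derivatives of L.  With Q = L^(M m) they differ by
    [ [P_+, Q]_+ - [Q_+, P]_+ - [P_+, Q_+], L ], by the Jacobi identity, and the
    inner operator is zero because [P, Q] = 0 and the bracket of two operators
    with negative powers has no nonnegative power ([zero_curvature]).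

    Flows on the Banach space.  The coefficients of L^(n+1) are given by those of
    L^n through a recursion with two terms ([dcoef_LopXS]); by induction on n they
    are bounded and Lipschitz on bounded sets of sequences, uniformly in the
    position.  Hence the vector field is Lipschitz on balls
    ([Xinf_field_lipschitz]) and Picard iteration applies
    ([local_flow_exists]).  It uses integration only through the existence of
    primitives of continuous curves, which are built coordinate by coordinate
    ([Xinf_has_primitives]); all other estimates come from the mean value
    inequality in normed spaces ([mean_value_inequality]).

    Solutions.  Along any solution, c_h satisfies a scalar linear equation
    c_h' = a c_h where a is bounded on segments.  A function with |f'| <= K |f| that
    vanishes at one point vanishes identically ([gronwall0]): a zero of c_h
    persists, and a real c_h that is somewhere positive has no zero, so it stays
    positive by the intermediate value theorem. *)

(* The name [shift] is also that of the translations of a normed space. *)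
Local Notation shift := Defs.shift.

(** * Difference operators and the Lax bracket *)

Section DiffOpTheory.
Variable A : comNzRingType.
Implicit Types (X Y Z : diffop A) (f g c : int -> A) (i j k : int).

Lemma dcoefD j X Y : dcoef j (X + Y) = dcoef j X + dcoef j Y.
Proof. exact: mcoeffD. Qed.

Lemma dcoefN j X : dcoef j (- X) = - dcoef j X.
Proof. exact: mcoeffN. Qed.

Lemma dcoefB j X Y : dcoef j (X - Y) = dcoef j X - dcoef j Y.
Proof. exact: mcoeffB. Qed.

Lemma dcoef0 j : dcoef j (0 : diffop A) = 0.
Proof. exact: mcoeff0. Qed.

Lemma dcoef_sum j (I : Type) (r : seq I) (P : pred I) (F : I -> diffop A) :
  dcoef j (\sum_(i <- r | P i) F i) = \sum_(i <- r | P i) dcoef j (F i).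
Proof. by apply: (big_morph _ (dcoefD j) (dcoef0 j)). Qed.

Lemma diffopP X Y : (forall j, dcoef j X = dcoef j Y) -> X = Y.
Proof. by move=> XY; apply/malgP. Qed.

(** Exposes the twisted product under the ring multiplication. *)
Lemma diffopM X Y : X * Y = dmul X Y.
Proof. by []. Qed.

(** Only the term of Y with index k - i contributes. *)
Lemma dcoef_dmonM k f i Y :
  dcoef k (dmon f i * Y) = f * shift i (dcoef (k - i) Y).
Proof.
rewrite diffopM {1}(diffopE Y) dmul_sumr dcoef_sum.
under eq_bigr do rewrite dmul_dmon dcoef_dmon.
have E j : (i + j == k) = (j == k - i) by rewrite addrC eq_sym -subr_eq eq_sym.
under eq_bigr do rewrite E.
case: (boolP (k - i \in msupp Y)) => kY; last first.
  rewrite big_seq big1 => [|j jY]; last by case: eqVneq jY kY => // -> ->.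
  by rewrite {1}/dcoef (mcoeff_outdom kY) Defs.shift0 mulr0.
rewrite (big_fsetD1 (k - i)) //= eqxx mulr1n big_seq big1 ?addr0 // => j.
by rewrite in_fsetD1 => /andP[/negbTE ->].
Qed.

Lemma dcoefM_dmon k X g j :
  dcoef k (X * dmon g j) = dcoef (k - j) X * shift (k - j) g.
Proof.
rewrite diffopM {1}(diffopE X) dmul_suml dcoef_sum.
under eq_bigr do rewrite dmul_dmon dcoef_dmon.
have E i : (i + j == k) = (i == k - j) by rewrite eq_sym -subr_eq eq_sym.
under eq_bigr do rewrite E.
case: (boolP (k - j \in msupp X)) => kX; last first.
  rewrite big_seq big1 => [|i iX]; last by case: eqVneq iX kX => // -> ->.
  by rewrite {1}/dcoef (mcoeff_outdom kX) mul0r.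
rewrite (big_fsetD1 (k - j)) //= eqxx mulr1n big_seq big1 ?addr0 // => i.
by rewrite in_fsetD1 => /andP[/negbTE ->].
Qed.

(** Supports are bounded by predicates instead of being computed: the arguments
    below only compare degrees. *)
Definition supported (P : pred int) X := forall j, ~~ P j -> dcoef j X = 0.

Lemma supportedB P X Y : supported P X -> supported P Y -> supported P (X - Y).
Proof. by move=> PX PY j Pj; rewrite dcoefB PX ?PY ?subr0. Qed.

Lemma supported_dmon (P : pred int) f i : P i -> supported P (dmon f i).
Proof. by move=> Pi j; rewrite dcoef_dmon; case: eqVneq => // <-; rewrite Pi. Qed.

Lemma supportedW {P Q : pred int} X : {subset P <= Q} ->
  supported P X -> supported Q X.
Proof. by move=> PQ PX j Qj; apply/PX/(contra _ Qj)/PQ. Qed.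

Lemma supportedM (P Q S : pred int) X Y :
  (forall i j, P i -> Q j -> S (i + j)) ->
  supported P X -> supported Q Y -> supported S (X * Y).
Proof.
move=> PQS PX QY k Sk; rewrite diffopM dcoef_sum big1 // => i _.
rewrite dcoef_sum big1 // => j _; rewrite dcoef_dmon.
have [Pi|/PX ->] := boolP (P i); last by rewrite mul0r mul0rn.
have [Qj|/QY ->] := boolP (Q j); last by rewrite Defs.shift0 mulr0 mul0rn.
by case: eqVneq => // ijk; case/negP: Sk; rewrite -ijk PQS.
Qed.

Lemma dcoef_pos_part j X :
  dcoef j (pos_part X) = if 0 <= j then dcoef j X else 0.
Proof.
rewrite /pos_part dcoef_sum.
under eq_bigr do rewrite dcoef_dmon.
case: ifP => j0; last first.
  by rewrite big1 // => i i0; case: eqVneq i0 => // ->; rewrite j0.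
case: (boolP (j \in msupp X)) => jX; last first.
  rewrite big_seq_cond big1 => [|i /andP[iX _]].
    by rewrite /dcoef (mcoeff_outdom jX).
  by case: eqVneq iX jX => // -> ->.
rewrite big_mkcond (big_fsetD1 j) //= j0 eqxx mulr1n big_seq big1 ?addr0 // => i.
by rewrite in_fsetD1 => /andP[/negbTE ->]; case: ifP.
Qed.

Lemma pos_partB X Y : pos_part (X - Y) = pos_part X - pos_part Y.
Proof.
apply: diffopP => j; rewrite dcoefB !dcoef_pos_part dcoefB.
by case: ifP => // _; rewrite subr0.
Qed.

Lemma pos_part_id X : supported (>= 0) X -> pos_part X = X.
Proof.
move=> X0; apply: diffopP => j; rewrite dcoef_pos_part.
by case: ifPn => // /X0.
Qed.

Lemma pos_part_eq0 X : supported (< 0) X -> pos_part X = 0.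
Proof.
move=> X0; apply: diffopP => j; rewrite dcoef_pos_part dcoef0.
by case: ifPn => // j0; apply: X0; rewrite /= -leNgt.
Qed.

Lemma supported_pos_part X : supported (>= 0) (pos_part X).
Proof. by move=> j /negbTE j0; rewrite dcoef_pos_part j0. Qed.

Lemma supported_neg_part X : supported (< 0) (X - pos_part X).
Proof.
move=> j; rewrite /= -leNgt => j0.
by rewrite dcoefB dcoef_pos_part j0 subrr.
Qed.

Lemma subrACA (V : zmodType) (a b d e : V) : a - b - (d - e) = a - d - (b - e).
Proof. by rewrite !opprD !opprK !addrA [a - b - d]addrAC. Qed.

Lemma commutatorBl X Y Z :
  commutator (X - Y) Z = commutator X Z - commutator Y Z.
Proof. by rewrite /commutator mulrBl mulrBr subrACA. Qed.

Lemma commutatorBr X Y Z :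
  commutator X (Y - Z) = commutator X Y - commutator X Z.
Proof. by rewrite /commutator mulrBl mulrBr subrACA. Qed.

Lemma commutatorN X Y : commutator X Y = - commutator Y X.
Proof. by rewrite /commutator opprB. Qed.

Section Lax.
Variables p q : nat.
Hypothesis hp : (1 <= p)%N.

Lemma dcoef_LopM c X j h : dcoef j (Lop p q c * X) h =
  dcoef (j - q%:Z) X (h + q%:Z) + c h * dcoef (j + p%:Z) X (h - p%:Z).
Proof. by rewrite mulrDl dcoefD !dcoef_dmonM mul1r opprK. Qed.

(** The recursion through which every estimate on powers of L is proved. *)
Lemma dcoef_LopXS c n j h : dcoef j (Lop p q c ^+ n.+1) h =
  dcoef (j - q%:Z) (Lop p q c ^+ n) (h + q%:Z)
  + c h * dcoef (j + p%:Z) (Lop p q c ^+ n) (h - p%:Z).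
Proof. by rewrite exprS dcoef_LopM. Qed.

Lemma dcoef_Lop c j : dcoef j (Lop p q c) =
  if j == q%:Z then 1 else if j == - p%:Z then c else 0.
Proof.
rewrite dcoefD !dcoef_dmon ![_ == j]eq_sym; case: eqVneq => [->|_].
  have /negbTE -> : q%:Z != - p%:Z by lia.
  by rewrite addr0.
by case: eqVneq; rewrite ?add0r.
Qed.

(** L has the two exponents q and -p, which are congruent modulo p + q. *)
Lemma supported_LopX c n :
  supported (fun j => ((p + q)%:Z %| j - (n * q)%:Z)%Z) (Lop p q c ^+ n).
Proof.
elim: n => [|n IH].
  rewrite expr0.
  apply: (@supported_dmon (fun j => ((p + q)%:Z %| j - (0 * q)%:Z)%Z) 1 0).
  by rewrite mul0n subr0 dvdz0.
rewrite exprS.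
apply: (@supportedM (fun j => (j == q%:Z) || (j == - p%:Z)) _ _ _ _ _ _ IH).
  move=> i j /orP[] /eqP -> jn.
    by have -> : q%:Z + j - (n.+1 * q)%:Z = j - (n * q)%:Z by lia.
  have -> : - p%:Z + j - (n.+1 * q)%:Z = (j - (n * q)%:Z) - (p + q)%:Z by lia.
  by rewrite rpredB // dvdzz.
by move=> j; rewrite negb_or dcoef_Lop => /andP[/negbTE -> /negbTE ->].
Qed.

Lemma supported_LopXM c l :
  supported (fun j => ((p + q)%:Z %| j)%Z) (Lop p q c ^+ ((p + q) * l)).
Proof.
apply: supportedW (@supported_LopX c _) => j.
have E : ((p + q)%:Z %| ((p + q) * l * q)%:Z)%Z.
  by rewrite -mulnA PoszM dvdz_mulr.
by rewrite -!topredE /= rpredBr.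
Qed.

(** [P_+, L] = - [P - P_+, L] because P is a power of L.  On the left only
    powers >= -p of the shift occur.  On the right P - P_+ has negative powers
    divisible by p + q, hence <= -(p + q), and only powers <= q - (p + q) = -p
    occur.  At the power -p, the term of P_+ that meets c S^(-p) is res P. *)
Theorem lax_rhsE l c : lax_rhs p q l c =
  dmon (c * (varrho p q l c - shift (- p%:Z) (varrho p q l c))) (- p%:Z).
Proof.
rewrite /lax_rhs /varrho /res; set P := Lop p q c ^+ _; set L := Lop p q c.
have PL : commutator P L = 0.
  by apply/eqP; rewrite subr_eq0; apply/eqP/commr_sym/commrX.
have neg : commutator (pos_part P) L = - commutator (P - pos_part P) L.
  by rewrite commutatorBl PL sub0r opprK.
have suppL : supported (fun j => (j == q%:Z) || (j == - p%:Z)) L.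
  by move=> j; rewrite negb_or dcoef_Lop => /andP[/negbTE -> /negbTE ->].
have suppN : supported (<= - (p + q)%:Z) (P - pos_part P).
  move=> j jpq; have [j0|j0] := leP 0 j.
    by apply: supported_neg_part; rewrite -leNgt.
  rewrite dcoefB dcoef_pos_part leNgt j0 subr0; apply: supported_LopXM => //.
  apply: contra jpq => /dvdzP[k jk] /=; move: j0; rewrite jk => j0.
  have M0 : 0 < (p + q)%:Z by lia.
  rewrite -mulN1r ler_pM2r //.
  by move: j0; rewrite pmulr_llt0 //; lia.
apply: diffopP => k; rewrite dcoef_dmon; have [kp|kp|->] := ltgtP k (- p%:Z).
- rewrite mulr0n.
  suff : supported (>= - p%:Z) (commutator (pos_part P) L).
    by apply; rewrite /= -ltNge.
  apply: supportedB; [apply: supportedM (@supported_pos_part P) suppL|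
    apply: supportedM suppL (@supported_pos_part P)] => i j /=; lia.
- rewrite mulr0n neg.
  suff suppC : supported (<= - p%:Z) (commutator (P - pos_part P) L).
    by rewrite dcoefN suppC ?oppr0 //= -ltNge.
  apply: supportedB; [apply: supportedM suppN suppL|
    apply: supportedM suppL suppN] => i j /=; lia.
(* At S^(-p), the bracket with S^q sees P_+ only at the power -p - q < 0. *)
rewrite mulr1n /commutator {1 2}/L mulrDl mulrDr dcoefB !dcoefD.
rewrite !dcoef_dmonM !dcoefM_dmon.
have pq : - p%:Z - q%:Z < 0 by lia.
rewrite subrr !dcoef_pos_part leNgt pq /= mul0r add0r Defs.shift0 mulr0 add0r.
by rewrite shift0r mulrBr mulrC.
Qed.
End Lax.
End DiffOpTheory.

(** * The zero curvature identity *)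

Section ZeroCurvature.
Variable A : comNzRingType.
Implicit Types X Y Z : diffop A.

Lemma commutator_jacobi X Y Z :
  commutator Y (commutator X Z) - commutator X (commutator Y Z) =
  commutator (commutator Y X) Z.
Proof.
rewrite /commutator !mulrBl !mulrBr !mulrA.
have E (V : zmodType) (a b d e f g : V) :
    a - b - (d - e) - (f - d - (b - g)) = a - f - (g - e).
  rewrite !opprD !opprK !addrA.
  by rewrite [LHS](ACl (1*5*8*4*(2*7)*(3*6)))%AC /= !addNr !addr0.
exact: E.
Qed.

Lemma commutatorBB X Y X' Y' : commutator X Y = 0 ->
  commutator (X - X') (Y - Y') =
  commutator Y' X - (commutator X' Y - commutator X' Y').
Proof.
move=> XY; rewrite commutatorBl (commutatorBr X) (commutatorBr X') XY sub0r.
by rewrite (commutatorN Y' X).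
Qed.

(** With a = X_+ and b = Y_+, the bracket of the strictly negative parts
    [X - a, Y - b] = [X, Y] + [b, X] - [a, Y] + [a, b] has nonnegative part 0,
    whereas [a, b] is its own nonnegative part. *)
Lemma commutator_pos_part X Y : commutator X Y = 0 ->
  pos_part (commutator (pos_part X) Y) - pos_part (commutator (pos_part Y) X) =
  commutator (pos_part X) (pos_part Y).
Proof.
move=> XY; set a := pos_part X; set b := pos_part Y.
have ab0 : pos_part (commutator (X - a) (Y - b)) = 0.
  by apply/pos_part_eq0/supportedB; apply: supportedM (@supported_neg_part _ _)
    (@supported_neg_part _ _) => i j /=; lia.
have abE : pos_part (commutator a b) = commutator a b.
  by apply/pos_part_id/supportedB; apply: supportedM (@supported_pos_part _ _)
    (@supported_pos_part _ _) => i j /=; lia.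
have E (U V W : diffop A) :
    pos_part (U - (V - W)) = 0 -> pos_part W = W -> pos_part V - pos_part U = W.
  rewrite pos_partB (pos_partB V) => UVW WE; move: UVW; rewrite WE.
  by move=> /eqP; rewrite subr_eq0 => /eqP ->; rewrite subKr.
by rewrite (commutatorBB a b XY) in ab0; exact: E ab0 abE.
Qed.

Section Coefficientwise.
Variable D : A -> A.
Hypothesis D0 : D 0 = 0.
Hypothesis DD : {morph D : f g / f + g}.
Hypothesis DM : forall f g, D (f * g) = D f * g + f * D g.

(** d/dt on difference operators, given d/dt on the coefficients. *)
Definition dmap X : diffop A :=
  \sum_(j <- msupp X) dmon (D \o dcoef j X) j.

Lemma dcoef_dmap j X h : dcoef j (dmap X) h = D (dcoef j X h).
Proof.
rewrite /dmap dcoef_sum.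
under eq_bigr do rewrite dcoef_dmon.
case: (boolP (j \in msupp X)) => jX; last first.
  rewrite big_seq big1 => [|i iX]; last by case: eqVneq iX jX => // -> ->.
  by rewrite {1}/dcoef (mcoeff_outdom jX) D0.
rewrite (big_fsetD1 j) //= eqxx mulr1n big_seq big1 ?addr0 // => i.
by rewrite in_fsetD1 => /andP[/negbTE ->].
Qed.

Lemma dmap_dmon f j : dmap (dmon f j) = dmon (D \o f) j.
Proof.
apply: diffopP => k; apply/funext => h; rewrite dcoef_dmap !dcoef_dmon.
by case: eqVneq.
Qed.

Lemma dmapD X Y : dmap (X + Y) = dmap X + dmap Y.
Proof.
apply: diffopP => k; apply/funext => h; rewrite dcoefD dcoef_dmap dcoefD.
by rewrite [LHS]DD -!dcoef_dmap.
Qed.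

Lemma dmap0 : dmap 0 = 0.
Proof. by rewrite /dmap msupp0 big_seq_fset0. Qed.

Lemma dmap_sum (I : Type) (r : seq I) (F : I -> diffop A) :
  dmap (\sum_(i <- r) F i) = \sum_(i <- r) dmap (F i).
Proof. by apply: (big_morph _ dmapD dmap0). Qed.

Lemma dmapN X : dmap (- X) = - dmap X.
Proof. by apply/eqP; rewrite -addr_eq0 -dmapD addNr dmap0. Qed.

Lemma dmapM X Y : dmap (X * Y) = dmap X * Y + X * dmap Y.
Proof.
rewrite !diffopM (diffopE X) dmap_sum !dmul_suml dmap_sum -big_split /=.
apply: eq_bigr => i _.
rewrite (diffopE Y) dmap_sum !dmul_sumr dmap_sum -big_split /=.
apply: eq_bigr => j _; rewrite !dmap_dmon !dmul_dmon dmap_dmon -dmonD.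
by congr dmon; apply/funext => h; apply: DM.
Qed.

Lemma dmapC X Y :
  dmap (commutator X Y) = commutator (dmap X) Y + commutator X (dmap Y).
Proof.
rewrite /commutator dmapD dmapN !dmapM (addrC (dmap Y * X)).
by rewrite opprD addrACA.
Qed.

Lemma dmap_pos_part X : dmap (pos_part X) = pos_part (dmap X).
Proof.
apply: diffopP => k; apply/funext => h.
by rewrite dcoef_dmap !dcoef_pos_part; case: ifP => //; rewrite dcoef_dmap.
Qed.

(** The Lax equation dX/dt = [B, X] is inherited by all powers of X. *)
Lemma dmapX X B n : dmap X = commutator B X ->
  dmap (X ^+ n) = commutator B (X ^+ n).
Proof.
move=> DX; elim: n => [|n IH]; last first.
  by rewrite exprS dmapM IH DX /commutator mulrBl mulrBr !mulrA addrA subrK.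
rewrite expr0 /commutator mulr1 mul1r subrr.
have /eqP := dmapM 1 1; rewrite !mul1r mulr1.
by rewrite -subr_eq subrr => /eqP <-.
Qed.

End Coefficientwise.

(** The two double derivatives differ by
    [[P_+, Q]_+ - [Q_+, P]_+ - [P_+, Q_+], L], whose left entry vanishes. *)
Lemma zero_curvature (D E : A -> A) (L : diffop A) (m n : nat) :
  D 0 = 0 -> {morph D : f g / f + g} ->
  (forall f g, D (f * g) = D f * g + f * D g) ->
  E 0 = 0 -> {morph E : f g / f + g} ->
  (forall f g, E (f * g) = E f * g + f * E g) ->
  dmap D L = commutator (pos_part (L ^+ m)) L ->
  dmap E L = commutator (pos_part (L ^+ n)) L ->
  dmap D (dmap E L) = dmap E (dmap D L).
Proof.
move=> D0 DD DM E0 ED EM DL EL.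
set P := L ^+ m in DL; set Q := L ^+ n in EL.
have PQ : commutator P Q = 0.
  apply/eqP; rewrite subr_eq0; apply/eqP/commrX/commr_sym/commrX.
  exact: commr_refl.
have DE : dmap D (commutator (pos_part Q) L) =
    commutator (pos_part (commutator (pos_part P) Q)) L
    + commutator (pos_part Q) (commutator (pos_part P) L).
  rewrite -DL -(dmapX D0 DD DM n DL) -(dmap_pos_part D0 Q).
  exact: (dmapC D0 DD DM).
have ED' : dmap E (commutator (pos_part P) L) =
    commutator (pos_part (commutator (pos_part Q) P)) L
    + commutator (pos_part P) (commutator (pos_part Q) L).
  rewrite -EL -(dmapX E0 ED EM m EL) -(dmap_pos_part E0 P).
  exact: (dmapC E0 ED EM).
rewrite EL DL DE ED'.
have swap (V : zmodType) (u v w z : V) : u - w = z - v -> u + v = w + z.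
  by move=> /eqP; rewrite subr_eq => /eqP ->; rewrite addrAC subrK addrC.
apply: swap.
refine (eq_trans (esym (commutatorBl _ _ _)) _).
refine (eq_trans _ (esym (commutator_jacobi (pos_part Q) (pos_part P) L))).
exact: (congr1 (fun Z => commutator Z L) (commutator_pos_part PQ)).
Qed.
End ZeroCurvature.

(** * Derivations of the polynomial algebra and the formal flows *)

Section PolynomialDerivations.
Variables (K : comNzRingType) (I : choiceType).
Local Notation T := {malg K[{cmonom I}]}.
Implicit Types (m : {cmonom I}) (f g : T).

Lemma cmonom_ind (P : {cmonom I} -> Prop) :
  P mone -> (forall i m, P m -> P (mmul (ucm i) m)) -> forall m, P m.
Proof.
move=> P1 PU m; have [n] := ubnP (mdeg m); elim: n m => // n IH m mn.
have [->//|m1] := eqVneq m mone.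
have [i im] : exists i, m i != 0%N.
  apply: contrapT => m0; case/eqP: m1; apply/eqP/cmP => i; rewrite cm1.
  by apply/eqP; apply: contrapT => /negP mi; apply: m0; exists i.
have mE : m = mmul (ucm i) (divcm m (ucm i)).
  apply/eqP/cmP => j; rewrite cmM divcmE ucmE.
  by case: eqVneq => [<-|_]; rewrite ?subn0 ?add0n // subnKC // lt0n.
by rewrite mE; apply/PU/IH; move: mn; rewrite {1}mE mdegM mdegU.
Qed.

Lemma malg_cmonom_ind (P : T -> Prop) :
  (forall a, P a%:MP) -> (forall i, P << ucm i >>) ->
  (forall f g, P f -> P g -> P (f + g)) ->
  (forall f g, P f -> P g -> P (f * g)) -> forall f, P f.
Proof.
move=> PC PU PD PM f; rewrite (monalgE f).
elim/big_ind: _ => [|//|m _]; first by rewrite -malgC0E.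
have -> : << f@_m *g m >> = (f@_m)%:MP * << m >> :> T.
  by rewrite malgM_def fgmulUU mulr1 mul1m.
apply: (PM); first exact: PC.
elim/cmonom_ind: m => [|i m Pm]; first exact: (PC 1).
have -> : << mmul (ucm i) m >> = << ucm i >> * << m >> :> T.
  by rewrite malgM_def fgmulUU mulr1.
exact: (PM _ _ (PU i) Pm).
Qed.

(* A derivation with prescribed values v on the unknowns is the coefficient of
   the first power of e in the substitution x_i := x_i + v_i e.  Reading it off
   the polynomials in e makes the Leibniz rule the product rule of
   coefficients. *)
Variable v : I -> T.

Definition dual_monom m : {poly T} :=
  \prod_(i <- finsupp m) (<< ucm i >>%:P + v i *: 'X) ^+ m i.

Lemma dual_monomEw m (d : {fset I}) : (finsupp m `<=` d)%fset ->
  dual_monom m = \prod_(i <- d) (<< ucm i >>%:P + v i *: 'X) ^+ m i.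
Proof.
move=> md; rewrite /dual_monom (big_fset_incl _ md) //= => i _.
by rewrite -cmE_eq0 => /eqP ->; rewrite expr0.
Qed.

Lemma dual_monom_mmorphism : mmorphism dual_monom.
Proof.
split=> [m n|]; last by rewrite /dual_monom mdom1 big_seq_fset0.
rewrite (dual_monomEw (m := m) (d := finsupp (mmul m n))) ?mdomD ?fsubsetUl //.
rewrite (dual_monomEw (m := n) (d := finsupp (mmul m n))) ?mdomD ?fsubsetUr //.
rewrite (dual_monomEw (m := (mmul m n)) (d := finsupp (mmul m n))) //.
rewrite mdomD -big_split /=; apply: eq_bigr => i _.
by rewrite cmM exprD.
Qed.
HB.instance Definition _ := isMultiplicative.Build _ _ dual_monom
  dual_monom_mmorphism.

Lemma exists_dual_eval : exists phi : T -> {poly T},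
  [/\ {morph phi : f g / f + g}, {morph phi : f g / f * g},
      forall a, phi a%:MP = a%:MP%:P &
      forall i, phi << ucm i >> = << ucm i >>%:P + v i *: 'X].
Proof.
pose c := polyC \o @malgC {cmonom I} K.
exists (mmap c dual_monom); split=> [f g|f g|a|i].
- exact: (@mmapD _ _ _ c dual_monom f g).
- exact: (@mmap_is_multiplicative _ _ _ c dual_monom).1.
- exact: (@mmapC _ _ _ c dual_monom a).
have -> : mmap c dual_monom << ucm i >> = 1 * dual_monom (ucm i).
  exact: (@mmapU _ _ _ c dual_monom 1 (ucm i)).
by rewrite mul1r /dual_monom mdomU big_seq_fset1 cmUU expr1.
Qed.

Lemma coef1M (A : nzSemiRingType) (P Q : {poly A}) :
  (P * Q)`_1 = P`_0 * Q`_1 + P`_1 * Q`_0.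
Proof. by rewrite coefM !big_ord_recl big_ord0 addr0. Qed.

Lemma exists_derivation : exists D : T -> T,
  [/\ forall a, D a%:MP = 0, {morph D : f g / f + g},
      forall f g, D (f * g) = D f * g + f * D g & forall i, D << ucm i >> = v i].
Proof.
have [phi [phiD phiM phiC phiU]] := exists_dual_eval.
have phi0 f : (phi f)`_0 = f.
  elim/malg_cmonom_ind: f => [a|i|f g IHf IHg|f g IHf IHg].
  - by rewrite phiC coefC.
  - by rewrite phiU coefD coefC coefZ coefX mulr0 addr0.
  - by rewrite phiD coefD IHf IHg.
  - by rewrite phiM coefM big_ord_recl big_ord0 addr0 /= IHf IHg.
exists (fun f => (phi f)`_1); split=> [a|f g|f g|i].
- by rewrite phiC coefC.
- by rewrite phiD coefD.
- by rewrite phiM coef1M (phi0 f) (phi0 g); exact: addrC.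
- by rewrite phiU coefD coefC coefZ coefX mulr1 add0r.
Qed.

End PolynomialDerivations.

Lemma leibniz_bracket (A : comNzRingType) (D E : A -> A) :
  {morph D : f g / f + g} -> (forall f g, D (f * g) = D f * g + f * D g) ->
  {morph E : f g / f + g} -> (forall f g, E (f * g) = E f * g + f * E g) ->
  forall f g, D (E (f * g)) - E (D (f * g)) =
    (D (E f) - E (D f)) * g + f * (D (E g) - E (D g)).
Proof. by move=> DD DM ED EM f g; rewrite EM DM DD ED !DM !EM; ring. Qed.

Section FormalFlow.
Variables (R : realType) (p q : nat).
Hypothesis hp : (1 <= p)%N.
Local Notation T := (cpoly R).
Local Notation x := (cvar R p).

Lemma cvar_lt h : h < p%:Z -> x h = 0.
Proof. by case: h => //= n; rewrite ltz_nat => ->. Qed.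

Lemma cvarE (k : nat) : x (p + k)%:Z = << ucm k >>.
Proof. by rewrite /= ltnNge leq_addr addKn. Qed.

Lemma derivation0 (D : T -> T) : derivation D -> D 0 = 0.
Proof. by case=> _ DD _; apply: (addrI (D 0)); rewrite -DD !addr0. Qed.

Lemma derivation1 (D : T -> T) : derivation D -> D 1 = 0.
Proof. by case=> DC _ _; apply: (DC 1). Qed.

Lemma derivationB (D E : T -> T) : derivation D -> derivation E ->
  derivation (fun f => D (E f) - E (D f)).
Proof.
move=> dD dE; have D0 := derivation0 dD; have E0 := derivation0 dE.
case: dD dE => DC DD DM [EC ED EM]; split => [a|f g|f g].
- by rewrite EC DC D0 E0 subr0.
- by rewrite DD ED DD ED opprD addrACA.
- exact: (leibniz_bracket DD DM ED EM).
Qed.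

(** The unknowns and the constants generate the algebra. *)
Lemma derivation_ext (D E : T -> T) : derivation D -> derivation E ->
  (forall h, D (x h) = E (x h)) -> D =1 E.
Proof.
case=> DC DD DM [EC ED EM] DE f.
elim/(@malg_cmonom_ind (Rcomplex R) nat): f => [a|k|f g IHf IHg|f g IHf IHg].
- by rewrite [LHS]DC [RHS]EC.
- by rewrite -cvarE DE.
- by rewrite DD ED IHf IHg.
- by rewrite DM EM IHf IHg.
Qed.

(** At S^q the Lax equation says that the constant 1 is killed, and at S^(-p) it
    prescribes the image of every unknown. *)
Lemma formal_flowE l (D : T -> T) : formal_flow p q l D <->
  derivation D /\ forall h, D (x h) =
    x h * (varrho p q l x h - varrho p q l x (h - p%:Z)).
Proof.
split=> -[dD DL]; split=> //.
  move=> h; have := DL (- p%:Z) h; rewrite lax_rhsE // dcoef_dmon eqxx dcoef_Lop //.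
  have /negbTE -> : - p%:Z != q%:Z by lia.
  by rewrite eqxx.
move=> j h; rewrite lax_rhsE // dcoef_dmon dcoef_Lop //.
have [-> |jq] := eqVneq j q%:Z.
  have /negbTE -> : - p%:Z != q%:Z by lia.
  exact: (derivation1 dD).
rewrite eq_sym; case: eqVneq => _; last exact: derivation0.
exact: DL.
Qed.

Lemma exists_formal_flow l : exists D : T -> T, formal_flow p q l D.
Proof.
pose r := varrho p q l x.
have [D [DC DD DM DU]] := @exists_derivation (Rcomplex R) nat
  (fun k => x (p + k)%:Z * (r (p + k)%:Z - r ((p + k)%:Z - p%:Z))).
have dD : derivation D by [].
exists D; apply/formal_flowE; split=> // h; have [hp'|] := leP p%:Z h.
  have -> : h = (p + `|h - p%:Z|)%:Z by lia.
  by rewrite {1}cvarE DU.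
by move=> /cvar_lt ->; rewrite mul0r derivation0.
Qed.

(** D E - E D is a derivation, so it is enough to test it on the coefficients of
    L, where it vanishes by [zero_curvature]. *)
Lemma formal_flows_commute l m (D E : T -> T) :
  formal_flow p q l D -> formal_flow p q m E -> forall f, D (E f) = E (D f).
Proof.
move=> [dD DL] [dE EL].
have D0 := derivation0 dD; have E0 := derivation0 dE.
have DhatL : dmap D (Lop p q x) =
    commutator (pos_part (Lop p q x ^+ ((p + q) * l))) (Lop p q x).
  by apply: diffopP => j; apply/funext => h; rewrite (dcoef_dmap D0) DL.
have EhatL : dmap E (Lop p q x) =
    commutator (pos_part (Lop p q x ^+ ((p + q) * m))) (Lop p q x).
  by apply: diffopP => j; apply/funext => h; rewrite (dcoef_dmap E0) EL.
have dC := derivationB dD dE.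
have d0 : derivation (fun=> 0 : T).
  by split=> [//|f g|f g]; rewrite ?addr0 // mul0r mulr0 addr0.
move=> f; apply/eqP; rewrite -subr_eq0; apply/eqP; move: f.
apply: (derivation_ext dC d0) => h; apply/eqP; rewrite subr_eq0; apply/eqP.
case: (dD) (dE) => _ DD DM [_ ED EM].
have := zero_curvature D0 DD DM E0 ED EM DhatL EhatL.
move=> /(congr1 (fun X => dcoef (- p%:Z) X h)).
rewrite !(dcoef_dmap D0, dcoef_dmap E0) dcoef_Lop // eqxx.
by have /negbTE -> : - p%:Z != q%:Z by lia.
Qed.

End FormalFlow.

(** * Mean value inequality and the linear comparison lemma *)

Section MeanValue.
Variables (R : realType) (V : normedModType R).
Implicit Types (f df : R -> V) (a b c t K M : R).

(** First-order expansion with explicit neighbourhoods, the form in which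
    derivatives are estimated, translated and built below. *)
Lemma is_deriveP f c (l : V) : is_derive c 1 f l <->
  forall e, 0 < e -> exists2 d, 0 < d &
    forall t, `|t - c| < d -> `|f t - f c - (t - c) *: l| <= e * `|t - c|.
Proof.
pose r h := h^-1 *: (f (h *: 1 + c) - f c).
have rE h : h != 0 -> `|l - r h| = `|f (h + c) - f c - h *: l| / `|h|.
  move=> h0; rewrite -normfV mulrC -normrZ scalerBr scalerA mulVf // scale1r.
  by rewrite distrC /r /= /GRing.scale /= mulr1.
have lP : is_derive c 1 f l <-> r h @[h --> 0^'] --> l.
  split=> [[fc <-]|rl]; first exact: fc.
  split; last exact: cvg_lim rl.
  by apply/cvg_ex; exists l.
rewrite lP; split.
  move=> /cvgrPdist_le rl e e0; have := rl e e0.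
  rewrite near_withinE => /nbhs_ballP[d /= d0 dl]; exists d => // t td.
  have [->|tc] := eqVneq t c; first by rewrite !subrr scale0r subrr !normr0 mulr0.
  have tc0 : t - c != 0 by rewrite subr_eq0.
  have := dl (t - c); rewrite /= -ball_normE /= sub0r normrN => /(_ td tc0).
  by rewrite rE // subrK ler_pdivrMr ?normr_gt0.
move=> H; apply/cvgrPdist_le => e e0; have [d d0 dl] := H e e0.
rewrite near_withinE; apply/nbhs_ballP; exists d => //= h.
rewrite -ball_normE /= sub0r normrN => hd h0.
rewrite rE // ler_pdivrMr ?normr_gt0 //.
by have := dl (h + c); rewrite addrK; apply.
Qed.

Lemma is_derive_continuous f c (l : V) :
  is_derive c 1 f l -> {for c, continuous f}.
Proof. by move=> [fc _]; apply/differentiable_continuous/derivable1_diffP. Qed.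

Lemma is_derive_within f df a b :
  (forall t, t \in `[a, b] -> is_derive t 1 f (df t)) ->
  {within `[a, b], continuous f}.
Proof.
move=> fd; apply: continuous_in_subspaceT => t; rewrite inE => tab.
exact/is_derive_continuous/fd.
Qed.

(** For e > 0, the maximum of |f t - f a| - (M + e) (t - a) on [a, b] is at a,
    where the value is 0: at any other point c, since |df c| < M + e, a slightly
    smaller t gives a larger value. *)
Lemma mean_value_inequality f df a b M : a <= b ->
  (forall t, t \in `[a, b] -> is_derive t 1 f (df t)) ->
  (forall t, t \in `[a, b] -> `|df t| <= M) ->
  `|f b - f a| <= M * (b - a).
Proof.
move=> ab fd dfM; have [->|ab'] := eqVneq a b; first by rewrite !subrr normr0 mulr0.
have {ab'}ab' : a < b by rewrite lt_neqAle ab' ab.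
suff H e : 0 < e -> `|f b - f a| <= (M + e) * (b - a).
  apply/ler_addgt0Pr => e e0.
  rewrite (le_trans (H (e / (b - a)) _)) ?divr_gt0 ?subr_gt0 //.
  by rewrite mulrDl divfK // subr_eq0 gt_eqF.
move=> e0; pose g t := `|f t - f a| - (M + e) * (t - a).
have gc : {within `[a, b], continuous g}.
  apply: continuous_in_subspaceT => t; rewrite inE => /fd /is_derive_continuous ft.
  apply: cvgB; first by apply: cvg_norm; apply: cvgB => //; exact: cvg_cst.
  by apply: cvgMr; apply: cvgB; [exact: cvg_id|exact: cvg_cst].
have [c cab gmax] := EVT_max ab gc.
have [ca|ca] := eqVneq c a.
  have := gmax b; rewrite ca in_itv /= lexx ab /g !subrr normr0 mulr0 => /(_ isT).
  by rewrite subr0 subr_le0.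
have ac : a < c by rewrite lt_neqAle eq_sym ca (itvP cab).
have /is_deriveP/(_ (e / 2))[] := fd c cab; first by rewrite divr_gt0.
move=> d d0 dc; pose t := Num.max a (c - d / 2).
have tc : t < c by rewrite gt_max ac ltrBlDr ltrDl divr_gt0.
have at' : a <= t by rewrite le_max lexx.
have td : `|t - c| < d.
  rewrite distrC gtr0_norm ?subr_gt0 // ltrBlDr -ltrBlDl lt_max.
  by rewrite ltrD2l ltrN2 ltr_pdivrMr // ltr_pMr ?ltr1n ?orbT.
have tab : t \in `[a, b] by rewrite in_itv /= at' (le_trans (ltW tc)) ?(itvP cab).
have := gmax t tab; rewrite leNgt => /negP[]; rewrite /g.
have F1 : `|f c - f t| <= (M + e / 2) * (c - t).
  rewrite mulrDl -[c - t]gtr0_norm ?subr_gt0 // distrC [ `|c - t|]distrC.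
  have -> : f t - f c = (t - c) *: df c + (f t - f c - (t - c) *: df c).
    by rewrite [RHS]addrC subrK.
  rewrite (le_trans (ler_normD _ _)) // lerD ?dc // normrZ mulrC.
  by rewrite ler_wpM2r ?dfM.
have F2 : `|f c - f a| <= `|f c - f t| + `|f t - f a| by exact: ler_distD.
have ct : 0 < c - t by rewrite subr_gt0.
nra.
Qed.

Lemma mean_value_inequality_dist f df a b M :
  (forall t, t \in `[Num.min a b, Num.max a b] -> is_derive t 1 f (df t)) ->
  (forall t, t \in `[Num.min a b, Num.max a b] -> `|df t| <= M) ->
  `|f b - f a| <= M * `|b - a|.
Proof.
have [ab|ba] := leP a b => fd dfM.
  by rewrite [ `|b - a|]ger0_norm ?subr_ge0 // (mean_value_inequality ab fd).
rewrite distrC [ `|b - a|]distrC [ `|a - b|]gtr0_norm ?subr_gt0 //.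
exact: mean_value_inequality (ltW ba) fd dfM.
Qed.

Lemma norm_bounded_within f a b : a <= b -> {within `[a, b], continuous f} ->
  exists2 c, c \in `[a, b] & forall t, t \in `[a, b] -> `|f t| <= `|f c|.
Proof.
move=> ab fc; apply: (@EVT_max R (fun t => `|f t|)) => //.
by move=> t; apply: cvg_norm; apply: fc.
Qed.

(** On a segment of length at most 1 / (2 |K|) containing a zero of f, the
    maximum D of |f| satisfies D <= D / 2; longer segments are covered by
    finitely many steps of such a length, taken from c in both directions. *)
Lemma gronwall0 f df a b K c :
  (forall t, t \in `[a, b] -> is_derive t 1 f (df t)) ->
  (forall t, t \in `[a, b] -> `|df t| <= K * `|f t|) ->
  c \in `[a, b] -> f c = 0 -> forall t, t \in `[a, b] -> f t = 0.
Proof.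
(* The step length; adding 1 keeps it finite when K = 0. *)
pose d : R := (2 * (`|K| + 1))^-1.
have d0 : 0 < d by rewrite invr_gt0 mulr_gt0 // addr_gt0 // ltr_pwDr.
have dK : `|K| * d <= 1 / 2.
  rewrite /d invfM mulrCA mul1r ler_piMr ?invr_ge0 //.
  by rewrite ler_pdivrMr ?mul1r ?lerDl ?ltr_pwDr.
move=> fd dfK; have step s t : s \in `[a, b] -> t \in `[a, b] ->
    `|t - s| <= d -> f s = 0 -> f t = 0.
  move=> sab tab std fs.
  pose l := Num.min s t; pose r := Num.max s t.
  have lr : l <= r by rewrite le_max ge_min lexx.
  have sub x : x \in `[l, r] -> x \in `[a, b].
    rewrite /l /r !in_itv /=; move: sab tab; rewrite !in_itv /=.
    by case: (leP s t) => st; lra.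
  have fdl x : x \in `[l, r] -> is_derive x 1 f (df x) by move=> /sub /fd.
  have [x xlr xmax] := norm_bounded_within lr (is_derive_within fdl).
  have slr : s \in `[l, r] by rewrite in_itv /= ge_min le_max lexx.
  have sxd : `|x - s| <= d.
    move: xlr std; rewrite /l /r in_itv /= !ler_norml.
    by case: (leP s t) => st; lra.
  have sxlr y : y \in `[Num.min s x, Num.max s x] -> y \in `[l, r].
    move: xlr slr; rewrite !in_itv /=; case: (leP s x); lra.
  have /(_ (`|K| * `|f x|)) := @mean_value_inequality_dist f df s x _
    (fun y ys => fdl y (sxlr y ys)).
  rewrite fs subr0 => H.
  have fx : `|f x| <= `|f x| / 2.
    rewrite (le_trans (H _)).
    - by [].
    - move=> y /sxlr ylr; rewrite (le_trans (dfK _ (sub _ ylr))) //.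
      by rewrite (le_trans (ler_wpM2r _ (ler_norm K))) // ler_wpM2l // xmax.
    - have KS : `|K| * `|x - s| <= 1 / 2 by rewrite (le_trans _ dK) // ler_wpM2l.
      by rewrite mulrAC; have := normr_ge0 (f x); nra.
  apply/eqP; rewrite -normr_le0 (le_trans (xmax t _)); first by [].
    by rewrite in_itv /= ge_min le_max lexx !orbT.
  by have := normr_ge0 (f x); lra.
move=> cab fc; suff main n t : t \in `[a, b] -> `|t - c| <= n%:R * d -> f t = 0.
  move=> t tab; apply: (main (Num.truncn (`|t - c| / d)).+1) => //.
  by rewrite -ler_pdivrMr // ltW // truncnS_gt.
elim: n t => [|n IH] t tab tn.
  suff -> : t = c by [].
  by apply/eqP; rewrite -subr_eq0 -normr_le0; move: tn; rewrite mul0r.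
(* The point at the fraction n / (n + 1) of the way from c to t. *)
pose h : R := n%:R / n.+1%:R.
have h0 : 0 <= h by rewrite divr_ge0.
have h1 : 0 <= 1 - h by rewrite subr_ge0 ler_pdivrMr // mul1r ler_nat.
have hn : h * n.+1%:R = n%:R by rewrite divfK.
have hn1 : (1 - h) * n.+1%:R = 1.
  by rewrite mulrBl hn mul1r -natr1 addrAC subrr add0r.
pose s := c + h * (t - c).
have sab : s \in `[a, b].
  move: tab cab; rewrite !in_itv /= /s => /andP[at' tb] /andP[ac cb].
  have := mulr_ge0 h0 (etrans (subr_ge0 _ _) at').
  have := mulr_ge0 h0 (etrans (subr_ge0 _ _) tb).
  have := mulr_ge0 h1 (etrans (subr_ge0 _ _) ac).
  have := mulr_ge0 h1 (etrans (subr_ge0 _ _) cb).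
  by lra.
apply: (step s t) => //.
  have -> : t - s = (1 - h) * (t - c) by rewrite /s; lra.
  rewrite normrM ger0_norm // (le_trans (ler_wpM2l h1 tn)) //.
  by rewrite mulrA hn1 mul1r.
apply: IH => //; rewrite /s addrC addKr normrM ger0_norm //.
by rewrite (le_trans (ler_wpM2l h0 tn)) // mulrA hn.
Qed.

End MeanValue.

Section LinearImage.
Variables (R : realType) (V W : normedModType R).

Lemma is_derive_linear (phi : {linear V -> W}) (f : R -> V) (t : R) (l : V) :
  (forall v, `|phi v| <= `|v|) -> is_derive t 1 f l ->
  is_derive t 1 (fun s => phi (f s)) (phi l).
Proof.
move=> phi1 /is_deriveP fl; apply/is_deriveP => e /fl[d d0 dl]; exists d => // s sd.
by rewrite -linearB -linearZ -linearB (le_trans (phi1 _)) // dl.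
Qed.

End LinearImage.

(** * Ordinary differential equations in Banach spaces *)

Section Picard.
Variables (R : realType) (V : completeNormedModType R) (F : V -> V).

Definition lipschitz_on_balls := forall N : R, exists2 K : R, 0 <= K &
  forall u v, `|u| <= N -> `|v| <= N -> `|F u - F v| <= K * `|u - v|.

(** The only form of integration that Picard iteration needs; how it is obtained
    depends on the space. *)
Definition has_primitives := forall (f : R -> V) (T : R), continuous f ->
  exists G : R -> V, forall t : R, `|t| <= T -> is_derive t 1 G (f t).

Hypothesis Flip : lipschitz_on_balls.
Hypothesis Vprim : has_primitives.

Lemma lipschitz_continuous (f : R -> V) (B : R) :
  (forall s t, `|f t - f s| <= B * `|t - s|) -> continuous f.
Proof.
move=> fB s; apply/cvgrPdist_le => e e0; apply/nbhs_ballP.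
have B1 : 0 < `|B| + 1 by rewrite ltr_pwDr.
exists (e / (`|B| + 1)); first by rewrite /= divr_gt0.
move=> t; rewrite /= distrC ltr_pdivlMr // => ts; rewrite distrC.
rewrite (le_trans (fB s t)) // ltW // (le_lt_trans _ ts) // mulrC.
by rewrite ler_wpM2l // (le_trans (ler_norm B)) // lerDl.
Qed.

(** The difference of two solutions satisfies |f'| <= K |f| on the segment from 0
    to t, with K the Lipschitz constant on a ball containing both arcs. *)
Lemma ode_unique (a b a' b' : R) (v w : R -> V) (t : R) :
  ode_solution F `]a, b[ v -> ode_solution F `]a', b'[ w ->
  0 \in `]a, b[ -> 0 \in `]a', b'[ -> t \in `]a, b[ -> t \in `]a', b'[ ->
  v 0 = w 0 -> v t = w t.
Proof.
move=> vF wF a0 a0' at' at'' vw0.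
pose l := Num.min 0 t; pose r := Num.max 0 t.
have lr : l <= r by rewrite le_max ge_min lexx.
have sv s : s \in `[l, r] -> is_derive s 1 v (F (v s)).
  move=> slr; apply: vF; move: slr a0 at'.
  by rewrite /= /l /r !in_itv /=; case: (leP 0 t) => ?; lra.
have sw s : s \in `[l, r] -> is_derive s 1 w (F (w s)).
  move=> slr; apply: wF; move: slr a0' at''.
  by rewrite /= /l /r !in_itv /=; case: (leP 0 t) => ?; lra.
have [x xlr xmax] := norm_bounded_within lr (is_derive_within sv).
have [y ylr ymax] := norm_bounded_within lr (is_derive_within sw).
have [K K0 FK] := Flip (Num.max `|v x| `|w y|).
have dvw s : s \in `[l, r] -> is_derive s 1 (v - w) (F (v s) - F (w s)).
  by move=> slr; apply: is_deriveB; [exact: sv|exact: sw].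
apply/eqP; rewrite -subr_eq0; apply/eqP.
apply: (@gronwall0 R V (v - w) (fun s => F (v s) - F (w s)) l r K 0) => //.
- by move=> s slr; apply: FK; rewrite le_max ?xmax ?ymax ?orbT.
- by rewrite in_itv /= ge_min le_max lexx.
- by apply/eqP; rewrite subr_eq0; apply/eqP.
- by rewrite in_itv /= ge_min le_max lexx !orbT.
Qed.

Lemma exists_geometric_lt (C e : R) : 0 < e -> exists n, C * 2^-1 ^+ n < e.
Proof.
move=> e0; have /cvgrPdist_lt/(_ e e0)[n _ /(_ n (leqnn n)) /=] :
    (fun n => C * 2^-1 ^+ n) @ \oo --> (C * 0 : R).
  by apply: cvgMr; apply: cvg_expr; rewrite ger0_norm ?invr_ge0 // invf_lt1 // ltr1n.
by rewrite mulr0 sub0r normrN => Cn; exists n; apply: le_lt_trans (ler_norm _) Cn.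
Qed.

Lemma geometric_cvg (x : nat -> V) :
  (forall n, `|x n.+1 - x n| <= 2^-1 ^+ n) ->
  exists y, forall n, `|y - x n| <= 2 * 2^-1 ^+ n.
Proof.
move=> xn.
have far n k : `|x (k + n)%N - x n| <= 2 * 2^-1 ^+ n.
  suff : `|x (k + n)%N - x n| <= 2 * 2^-1 ^+ n - 2 * 2^-1 ^+ (k + n).
    by move=> /le_trans; apply; rewrite lerBlDr lerDl mulr_ge0 ?exprn_ge0 ?invr_ge0.
  elim: k => [|k IH]; first by rewrite !subrr normr0.
  rewrite addSn (le_trans (ler_distD (x (k + n)%N) _ _)) //.
  rewrite (le_trans (lerD (xn _) IH)) // exprS.
  by lra.
have : cvg (x @ \oo).
  apply/cauchy_cvgP/cauchy_exP => e e0; have [n ne] := exists_geometric_lt 2 e0.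
  exists (x n); exists n => // m /= nm; rewrite -ball_normE /= distrC.
  by rewrite -(subnK nm) (le_lt_trans (far _ _)).
move=> /cvg_ex[y xy]; exists y => n; apply/ler_addgt0Pr => e e0.
have /cvgrPdist_le/(_ e e0)[m _ /(_ (m + n)%N (leq_addr _ _)) /= ym] := xy.
rewrite [leRHS]addrC (le_trans (ler_distD (x (m + n)%N) _ _)) // lerD //.
Qed.

Lemma between (T s t r : R) : `|s| <= T -> `|t| <= T ->
  r \in `[Num.min s t, Num.max s t] -> `|r| <= T.
Proof. by rewrite in_itv /= !ler_norml; case: (leP s t) => ?; lra. Qed.

Section FixedInterval.
Variables (N K B T : R).
Hypothesis K0 : 0 <= K.
Hypothesis FK : forall u v, `|u| <= N -> `|v| <= N -> `|F u - F v| <= K * `|u - v|.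
Hypothesis FB : forall u, `|u| <= N -> `|F u| <= B.
Hypotheses (T0 : 0 < T) (KT : K * T <= 2^-1) (BT : B * T <= 1).

(* Freezing the time outside [-T, T] makes the iterates defined and continuous
   on the whole line. *)
Let clamp (t : R) : R := Num.max (- T) (Num.min T t).

Let clamp_le t : `|clamp t| <= T.
Proof.
rewrite ler_norml le_max lexx ge_max ge_min lexx /= andbT.
by have := T0; lra.
Qed.

Let clampE t : `|t| <= T -> clamp t = t.
Proof.
rewrite /clamp ler_norml => /andP[t1 t2].
by rewrite min_r // max_r.
Qed.

Let clamp_lip s t : `|clamp t - clamp s| <= `|t - s|.
Proof.
rewrite /clamp ler_norml; have := ler_norm (t - s); have := ler_norm (s - t).
rewrite [ `|s - t|]distrC; have := T0.
have TT : Num.max (- T) T = T by rewrite max_r //; have := T0; lra.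
have [h1|h1] := leP T t; have [h2|h2] := leP T s;
  rewrite ?TT; try lra.
- by have [h3|h3] := leP (- T) s; lra.
- by have [h3|h3] := leP (- T) t; lra.
- by have [h3|h3] := leP (- T) s; have [h4|h4] := leP (- T) t; lra.
Qed.

Variable u : V.
Hypothesis uN : `|u| + 1 <= N.

Let B0 : 0 <= B.
Proof.
apply: le_trans (FB (u := u) _); rewrite ?normr_ge0 //.
by rewrite (le_trans _ uN) // lerDl.
Qed.

(* The B-Lipschitz bound passes to pointwise limits, which makes the limit of the
   iterates continuous without a uniform convergence argument. *)
Let candidate (x : R -> V) :=
  (forall t, `|t| <= T -> `|x t - u| <= 1) /\
  (forall s t, `|s| <= T -> `|t| <= T -> `|x t - x s| <= B * `|t - s|).

Let candidate_le x t : candidate x -> `|t| <= T -> `|x t| <= N.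
Proof.
move=> [xu _] tT; rewrite -[x t](subrK u) (le_trans (ler_normD _ _)) //.
by rewrite (le_trans _ uN) // addrC lerD ?xu.
Qed.

Let picard_step x : candidate x -> exists y, [/\ candidate y, y 0 = u &
  forall t : R, `|t| <= T -> is_derive t 1 y (F (x t))].
Proof.
move=> cx; have xN t := @candidate_le x t cx.
have /(@Vprim _ T)[G GF] : continuous (fun t => F (x (clamp t))).
  apply: (@lipschitz_continuous _ (K * B)) => s t.
  rewrite (le_trans (FK _ _)) ?xN // -mulrA ler_wpM2l //.
  by rewrite (le_trans (cx.2 _ _ _ _)) // ler_wpM2l.
pose y : R -> V := fun t => u + (G t - G 0).
have yF (t : R) : `|t| <= T -> is_derive t 1 y (F (x t)).
  move=> tT; rewrite -[F (x t)]add0r -[F (x t)]subr0.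
  apply: is_deriveD; apply: is_deriveB.
  by have := GF t tT; rewrite clampE.
have y0 : y 0 = u by rewrite /y subrr addr0.
have ylip (s t : R) : `|s| <= T -> `|t| <= T -> `|y t - y s| <= B * `|t - s|.
  move=> sT tT; apply: mean_value_inequality_dist => r /(between sT tT) rT.
    exact: yF.
  by rewrite FB // xN.
exists y; split => //; split=> // t tT.
have T0' : `|0 : R| <= T by rewrite normr0 ltW.
rewrite -{1}y0 (le_trans (ylip _ _ T0' tT)) // subr0 (le_trans _ BT) //.
by rewrite ler_wpM2l.
Qed.

(** The step S maps a candidate x to the primitive of F (x t) starting at u; it
    halves distances on [-T, T] since K T <= 1 / 2, so that its iterates converge
    geometrically to a fixed point. *)
Lemma picard_exists : exists w : R -> V, [/\ w 0 = u,
  forall t : R, `|t| <= T -> is_derive t 1 w (F (w t)) &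
  forall t, `|t| <= T -> `|w t| <= N].
Proof.
have /choice[S HS] : forall x, exists y, candidate x -> [/\ candidate y, y 0 = u &
    forall t : R, `|t| <= T -> is_derive t 1 y (F (x t))].
  move=> x; have [/picard_step[y Hy]|] := pselect (candidate x); first by exists y.
  by exists x.
have contract x x' D : candidate x -> candidate x' ->
    (forall t, `|t| <= T -> `|x t - x' t| <= D) ->
    forall t, `|t| <= T -> `|S x t - S x' t| <= D / 2.
  move=> cx cx' xD t tT; have [cS S0 SF] := HS x cx; have [cS' S0' SF'] := HS x' cx'.
  have T0' : `|0 : R| <= T by rewrite normr0 ltW.
  have D0 : 0 <= D := le_trans (normr_ge0 _) (xD 0 T0').
  have := @mean_value_inequality_dist R V (S x - S x')
    (fun t => F (x t) - F (x' t)) 0 t (K * D).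
  rewrite -![(_ - _ : R -> V) _]/(_ - _) S0 S0' subrr !subr0 => H.
  rewrite (le_trans (H _ _)).
  - by [].
  - move=> r /(between T0' tT) rT; apply: is_deriveB; [exact: SF|exact: SF'].
  - move=> r /(between T0' tT) rT.
    rewrite (le_trans (FK _ _)) ?candidate_le // ler_wpM2l // xD //.
  rewrite mulrAC mulrC ler_wpM2l // (le_trans _ KT) // ler_wpM2l //.
pose X n := iter n S (fun=> u).
have cX n : candidate (X n).
  elim: n => [|n /HS[]//]; split => [t _|s t _ _]; rewrite subrr normr0 //.
  by rewrite mulr_ge0.
have dX n t : `|t| <= T -> `|X n.+1 t - X n t| <= 2^-1 ^+ n.
  elim: n t => [|n IH] t tT.
    by have [[+ _] _ _] := HS _ (cX 0%N); apply.
  by rewrite exprSr; exact: (contract (X n.+1) (X n) _ (cX _) (cX _) IH).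
have /choice[y yX] : forall t, exists z, `|t| <= T ->
    forall n, `|z - X n t| <= 2 * 2^-1 ^+ n.
  move=> t; have [tT|] := pselect (`|t| <= T); last by exists 0.
  by have [z zX] := geometric_cvg (fun n => dX n t tT); exists z.
have small (z C : R) : (forall n, z <= C * 2^-1 ^+ n) -> z <= 0.
  move=> zC; apply/ler_addgt0Pr => e e0; rewrite add0r.
  by have [n Cn] := exists_geometric_lt C e0; apply: le_trans (zC n) (ltW Cn).
have cy : candidate y.
  split=> [t tT|s t sT tT]; rewrite -subr_le0.
    apply: (small _ 2) => n; rewrite lerBlDr.
    rewrite (le_trans (ler_distD (X n t) _ _)) // lerD ?yX //.
    exact: (cX n).1.
  apply: (small _ 4) => n; rewrite lerBlDr.
  have := ler_distD (X n t) (y t) (y s); have := ler_distD (X n s) (X n t) (y s).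
  have := yX t tT n; have := yX s sT n; have := (cX n).2 s t sT tT.
  by rewrite [ `|X n s - y s|]distrC; lra.
have [cw w0 wF] := HS y cy.
have wy t : `|t| <= T -> S y t = y t.
  move=> tT; apply/eqP; rewrite -subr_eq0 -normr_le0.
  apply: (small _ 3) => n.
  have := contract y (X n) _ cy (cX n) (fun t tT => yX t tT n) t tT.
  have := yX t tT n.+1; have := ler_distD (X n.+1 t) (S y t) (y t).
  rewrite [ `|X n.+1 t - y t|]distrC exprS -[S (X n)]/(X n.+1).
  have : 0 <= 2^-1 ^+ n :> R by rewrite exprn_ge0 ?invr_ge0.
  lra.
exists (S y); split=> // t tT; first by have := wF t tT; rewrite wy.
exact: candidate_le.
Qed.

End FixedInterval.

Lemma lipschitz_on_balls_continuous : continuous F.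
Proof.
move=> u; apply/cvgrPdist_le => e e0.
have [K K0 FK] := Flip (`|u| + 1).
apply/nbhs_ballP; exists (Num.min 1 (e / (K + 1))).
  by rewrite /= lt_min ltr01 divr_gt0 // ltr_wpDl.
move=> v; rewrite -ball_normE /= lt_min => /andP[uv1].
rewrite ltr_pdivlMr ?ltr_wpDl // => uve.
rewrite (le_trans (FK _ _ _ _)) ?lerDl //.
  rewrite -[v](subKr u) (le_trans (ler_normB _ _)) // lerD2l ltW //.
by rewrite mulrC (le_trans _ (ltW uve)) // ler_wpM2l // lerDl.
Qed.

Lemma ode_solution_C1 (a b : R) (v : R -> V) :
  ode_solution F `]a, b[%classic v -> C1_on `]a, b[%classic v.
Proof.
move=> vF t tab; have vt := vF t tab; split; first by case: vt.
have dE s : s \in `]a, b[ -> F (v s) = derive1 v s.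
  by move=> /vF vs; rewrite derive1E derive_val.
rewrite /prop_for /continuous_at -dE //.
have Fv : F (v s) @[s --> t] --> F (v t).
  apply: cvg_comp; first exact: is_derive_continuous vt.
  exact: lipschitz_on_balls_continuous.
apply: cvg_trans Fv; apply: near_eq_cvg.
have : nbhs t `]a, b[%classic by apply: open_nbhs_nbhs; split=> //; exact: itv_open.
by apply: filterS => s /dE.
Qed.

Lemma ode_solution_shift (a b t : R) (v : R -> V) :
  ode_solution F `]a, b[%classic v ->
  ode_solution F `]a - t, b - t[%classic (fun s => v (s + t)).
Proof.
move=> vF s; rewrite /= in_itv /= => sab.
have : (s + t) \in `]a, b[ by rewrite in_itv /=; lra.
move=> /vF/is_deriveP H; apply/is_deriveP => e /H[d d0 dv]; exists d => // r rs.
have E : r + t - (s + t) = r - s by rewrite opprD addrACA subrr addr0.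
by have := dv (r + t); rewrite E; apply.
Qed.

(** Dependence on the initial value: by the mean value inequality the maximum D
    of |W u - W v| on [-T, T] satisfies D <= |u - v| + K T D, and K T <= 1 / 2.
    The group law is uniqueness for the translated solution s |-> W u (s + t). *)
Theorem local_flow_exists (u0 : V) : exists (r T : R) (Phi : R -> V -> V),
  [/\ 0 < r, 0 < T & unique_local_C1_flow F u0 r T Phi].
Proof.
(* Solutions start within 1 of u0 and move by at most B T <= 1. *)
pose N := `|u0| + 2; have [K K0 FK] := Flip N.
pose B := `|F 0| + K * N.
have N0 : 0 <= N by rewrite addr_ge0.
have B0 : 0 <= B by rewrite addr_ge0 ?mulr_ge0.
have FB u : `|u| <= N -> `|F u| <= B.
  move=> uN; rewrite -[F u](subrK (F 0)) (le_trans (ler_normD _ _)) //.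
  rewrite addrC lerD // (le_trans (FK _ _ _ _)) ?normr0 // subr0.
  by rewrite ler_wpM2l.
pose T := (2 * (K + B + 1))^-1.
have KB : 0 < K + B + 1 by rewrite ltr_wpDl // addr_ge0.
have T0 : 0 < T by rewrite invr_gt0 mulr_gt0.
have KT : K * T <= 2^-1.
  rewrite /T invfM mulrCA ler_piMr ?invr_ge0 // ler_pdivrMr // mul1r.
  by rewrite -addrA lerDl addr_ge0.
have BT : B * T <= 1.
  rewrite /T ler_pdivrMr ?mulr_gt0 // mul1r; lra.
have uN u : ball u0 1 u -> `|u| + 1 <= N.
  rewrite -ball_normE /= /N => u01; rewrite -[u](subKr u0).
  have := ler_normB u0 (u0 - u); lra.
have /choice[W HW] : forall u, exists w : R -> V, ball u0 1 u -> [/\ w 0 = u,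
    forall t : R, `|t| <= T -> is_derive t 1 w (F (w t)) &
    forall t, `|t| <= T -> `|w t| <= N].
  move=> u; have [/uN|] := pselect (ball u0 1 u); last by exists (fun=> 0).
  by move=> /(picard_exists K0 FK FB T0 KT BT)[w Hw]; exists w.
have inT (t : R) : t \in `]- T, T[ -> `|t| <= T.
  by rewrite in_itv /= ler_norml => /andP[/ltW -> /ltW ->].
have WF u : ball u0 1 u -> ode_solution F `]- T, T[%classic (W u).
  by move=> /HW[_ uF _] t /inT /uF.
have T00 : 0 \in `]- T, T[ by rewrite in_itv /= oppr_lt0 T0.
have uniq u (a b : R) (v : R -> V) : ball u0 1 u -> a < 0 -> 0 < b ->
    ode_solution F `]a, b[%classic v -> v 0 = u ->
    forall t, t \in `]a, b[ -> t \in `]- T, T[ -> v t = W u t.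
  move=> u1 a0 b0 vF v0 t tab tT.
  apply: (ode_unique vF (WF u u1)) => //; first by rewrite in_itv /= a0.
  by have [->] := HW u u1.
have Wlip u v (t : R) : ball u0 1 u -> ball u0 1 v -> `|t| <= T ->
    `|W u t - W v t| <= 2 * `|u - v|.
  move=> u1 v1 tT; have [u_0 uF uN'] := HW u u1; have [v_0 vF vN] := HW v v1.
  have TT : - T <= T by lra.
  have inTT (s : R) : s \in `[- T, T] -> `|s| <= T by rewrite in_itv /= ler_norml.
  have dW (s : R) : s \in `[- T, T] ->
      is_derive s 1 (fun s => W u s - W v s) (F (W u s) - F (W v s)).
    by move=> /inTT sT; apply: is_deriveB; [exact: uF|exact: vF].
  have [x xT xmax] := norm_bounded_within TT (is_derive_within dW).
  have T0' : `|0 : R| <= T by rewrite normr0 ltW.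
  have itvT (s : R) : s \in `[Num.min 0 x, Num.max 0 x] -> s \in `[- T, T].
    by move=> /(between T0' (inTT x xT)); rewrite in_itv /= ler_norml.
  have /(_ (K * `|W u x - W v x|)) H := mean_value_inequality_dist
    (fun s sx => dW s (itvT s sx)).
  have {}H : `|W u x - W v x - (u - v)| <= K * `|W u x - W v x| * `|x|.
    move: H; rewrite u_0 v_0 subr0; apply=> s /itvT sT.
    by rewrite (le_trans (FK _ _ _ _)) ?uN' ?vN ?inTT // ler_wpM2l // xmax.
  rewrite (le_trans (xmax t _)); first by [].
    by rewrite in_itv /= -ler_norml.
  have KTx : K * `|x| <= 2^-1 by rewrite (le_trans _ KT) // ler_wpM2l // inTT.
  have : `|W u x - W v x| <= `|W u x - W v x - (u - v)| + `|u - v|.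
    by rewrite -{1}[W u x - W v x](subrK (u - v)) ler_normD.
  by move: H; rewrite mulrAC; have := normr_ge0 (W u x - W v x); nra.
exists 1, T, (fun t u => W u t); split=> //; split=> //.
- move=> u u1; have [w0 wF wN] := HW u u1; split=> //; first exact: WF.
  exact/ode_solution_C1/WF.
- move=> t u tT u1; apply/cvgrPdist_le => e e0.
  have tT' : 0 < T - `|t| by move: tT; rewrite in_itv /= subr_gt0 ltr_norml.
  have u1' : 0 < 1 - `|u0 - u| by move: u1; rewrite -ball_normE /= subr_gt0.
  have B2 : 0 < B + 2 by rewrite ltr_wpDl.
  pose d := Num.min (e / (B + 2)) (Num.min (T - `|t|) (1 - `|u0 - u|)).
  have d0 : 0 < d by rewrite !lt_min divr_gt0 ?tT'.
  exists (ball t d, ball u d); first by split; exact: nbhsx_ballx.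
  move=> [s v] /= []; rewrite -!ball_normE /= => ts uv.
  move: (ts) (uv); rewrite !lt_min => /and3P[tse tsT _] /and3P[uve _ uv1].
  have sT : s \in `]- T, T[.
    rewrite in_itv /= -ltr_norml -[s](subKr t) (le_lt_trans (ler_normB _ _)) //.
    by rewrite -ltrBrDl.
  have v1 : ball u0 1 v.
    rewrite -ball_normE /= (le_lt_trans (ler_distD u _ _)) //.
    by rewrite -ltrBrDl.
  have [w0 wF wN] := HW u u1.
  have tsB : `|W u t - W u s| <= B * `|t - s|.
    apply: mean_value_inequality_dist => r rts.
      by apply: wF; apply: between rts; apply: inT.
    by apply/FB/wN; apply: between rts; apply: inT.
  have := ler_distD (W u s) (W u t) (W v s).
  have := Wlip u v s u1 v1 (inT s sT).
  rewrite !ltr_pdivlMr // in tse uve; nra.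
- move=> s t u sT tT stT u1 Phiu1; symmetry.
  apply: (uniq _ (- T - t) (T - t) (fun s => W u (s + t))) => //.
  + by move: tT; rewrite in_itv /=; lra.
  + by move: tT; rewrite in_itv /=; lra.
  + exact: ode_solution_shift (WF u u1).
  + by rewrite add0r.
  + by move: stT; rewrite !in_itv /=; lra.
Qed.

Lemma lipschitz_on_balls_locally : locally_lipschitz F.
Proof.
move=> u; have [K K0 FK] := Flip (`|u| + 1); exists 1 => //.
exists K; split; first exact: num_real.
move=> L KL [v w] [/= uv uw].
have near u' : ball u 1 u' -> `|u'| <= `|u| + 1.
  rewrite -ball_normE /= => uu; rewrite -[u'](subKr u).
  by rewrite (le_trans (ler_normB _ _)) // lerD2l ltW.
by rewrite (le_trans (FK _ _ (near _ uv) (near _ uw))) // ler_wpM2r // ltW.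
Qed.
End Picard.

(** * Estimates on the powers of L *)

Section Estimates.
Variables (R : realType) (p q : nat).
Local Notation C := (Rcomplex R).
Implicit Types (c : int -> Rcomplex R) (x y : Rcomplex R) (N d : R).

Lemma Rcomplex_normM x y : `|x * y : Rcomplex R| = `|x| * `|y|.
Proof. exact: ComplexField.Normc.normcM. Qed.

Lemma Rcomplex_norm1 : `|1 : Rcomplex R| = 1.
Proof. exact: ComplexField.Normc.normc1. Qed.

Lemma norm_dcoef1_le j h : `|dcoef j (1 : diffop C) h : C| <= 1.
Proof.
have E (x : Rcomplex R) : x = 1 \/ x = 0 -> `|x| <= 1.
  by case=> ->; rewrite ?normr0 // (Rcomplex_norm1).
by apply: E; rewrite [dcoef j _](dcoef_dmon 0 1 j); case: eqVneq; [left|right].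
Qed.

Lemma LopX_bounded n N : 0 <= N -> exists2 B, 0 <= B &
  forall c, (forall h, `|c h| <= N) ->
  forall j h, `|dcoef j (Lop p q c ^+ n) h : C| <= B.
Proof.
move=> N0; elim: n => [|n [B B0 IH]].
  by exists 1 => // c _ j h; exact: norm_dcoef1_le.
exists (B + N * B); first by rewrite addr_ge0 ?mulr_ge0.
move=> c cN j h; rewrite dcoef_LopXS (le_trans (ler_normD _ _)) //.
by rewrite lerD ?IH // Rcomplex_normM ler_pM ?IH.
Qed.

Lemma norm_recursion_le (x y a x' y' a' : C) N B d e :
  `|x - x'| <= e -> `|y - y'| <= e -> `|a| <= N -> `|y'| <= B ->
  `|a - a'| <= d ->
  `|x + a * y - (x' + a' * y') : C| <= e + (N * e + d * B).
Proof.
move=> xe ye aN yB ad.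
have -> : x + a * y - (x' + a' * y') =
    (x - x') + (a * (y - y') + (a - a') * y') by ring.
rewrite (le_trans (ler_normD _ _)) // lerD // (le_trans (ler_normD _ _)) //.
by rewrite !Rcomplex_normM lerD // ler_pM.
Qed.

Lemma LopX_lipschitz n N : 0 <= N -> exists2 K, 0 <= K &
  forall c c' d, (forall h, `|c h| <= N) -> (forall h, `|c' h| <= N) ->
  (forall h, `|c h - c' h : C| <= d) ->
  forall j h, `|dcoef j (Lop p q c ^+ n) h - dcoef j (Lop p q c' ^+ n) h : C|
              <= K * d.
Proof.
move=> N0; elim: n => [|n [K K0 IH]].
  by exists 0 => // c c' d _ _ _ j h; rewrite subrr normr0 mul0r.
have [B B0 BN] := LopX_bounded n N0.
exists (K + (N * K + B)); first by rewrite !addr_ge0 ?mulr_ge0.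
move=> c c' d cN cN' cd j h; have eqs (x x' z z' : C) e :
    x = z -> x' = z' -> `|z - z'| <= e -> `|x - x'| <= e by move=> -> ->.
apply: eqs (dcoef_LopXS p q c n j h) (dcoef_LopXS p q c' n j h) _.
rewrite mulrDl mulrDl -mulrA [B * d]mulrC.
by apply: norm_recursion_le; rewrite ?cN ?cd //; [exact: IH|exact: IH|exact: BN].
Qed.

(** A given coefficient of a power of L involves finitely many values of c, so
    that c needs to be bounded at each position only, without uniformity. *)
Lemma LopX_bounded_on (c : R -> int -> Rcomplex R) (a b : R) n :
  (forall h, exists N, forall t, t \in `[a, b] -> `|c t h| <= N) ->
  forall j h, exists B, forall t, t \in `[a, b] ->
    `|dcoef j (Lop p q (c t) ^+ n) h : C| <= B.
Proof.
move=> cN; elim: n => [|n IH] j h.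
  by exists 1 => t _; exact: norm_dcoef1_le.
have [B1 HB1] := IH (j - q%:Z) (h + q%:Z).
have [B2 HB2] := IH (j + p%:Z) (h - p%:Z).
have [N HN] := cN h.
exists (B1 + N * B2) => t tab; rewrite dcoef_LopXS.
rewrite (le_trans (ler_normD _ _)) // lerD ?HB1 // Rcomplex_normM.
by rewrite ler_pM ?HN ?HB2.
Qed.

End Estimates.

(** * Primitives of continuous curves *)

Section Primitives.
Variable R : realType.
Implicit Types (g G : R -> R) (S M : R).

Lemma is_derive_subC g (t l a : R) : derivable g t 1 ->
  derive1 g t = l -> is_derive t 1 (fun s => g s - a) l.
Proof.
rewrite derive1E => dg <-; rewrite -[X in is_derive _ _ _ X]subr0.
exact: is_deriveB.
Qed.

Lemma real_primitive g S : continuous g ->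
  exists2 G : R -> R, G 0 = 0 & forall t : R, `|t| <= S -> is_derive t 1 G (g t).
Proof.
move=> cg; pose a := - `|S| - 1; pose b := `|S| + 1.
have gi : lebesgue_measure.-integrable `[a, b] (EFin \o g).
  apply: continuous_compact_integrable; first exact: segment_compact.
  exact: continuous_subspaceT.
pose G x := (\int[lebesgue_measure]_(t in `[a, x]) g t)%R.
exists (fun t => G t - G 0); first by rewrite subrr.
move=> t tS; have := ler_norm S; have := normr_ge0 S.
move: tS; rewrite ler_norml => /andP[t1 t2] S0 SS.
have tb : t < b by rewrite /b; lra.
have at' : a < t by rewrite /a; lra.
have [dG G'] := continuous_FTC1_closed tb gi at' (cg t).
exact: is_derive_subC dG G'.
Qed.

(** The equation G' = g on [-S, S] with G 0 = 0, in integrated form: the deviation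
    of G from an affine function is controlled by that of g from its slope.
    Such bounds can be taken with the same constants for a whole sequence of
    functions, as differentiability in the sup norm requires. *)
Definition primitive_on S g G := G 0 = 0 /\
  forall s t l e : R, `|s| <= S -> `|t| <= S ->
    (forall r, r \in `[Num.min s t, Num.max s t] -> `|g r - l| <= e) ->
    `|G t - G s - (t - s) * l| <= e * `|t - s|.

Lemma exists_primitive_on S g : continuous g -> exists G, primitive_on S g G.
Proof.
move=> /(@real_primitive _ S)[G G0 dG]; exists G; split=> // s t l e sS tS gl.
have dGl (r : R) : r \in `[Num.min s t, Num.max s t] ->
    is_derive r 1 (fun r => G r - r * l) (g r - l).
  move=> /(between sS tS)/dG dGr; apply: is_deriveB.
  apply/is_deriveP => d d0; exists 1 => // r' _.
  by rewrite -mulrBl subrr normr0 mulr_ge0 // ltW.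
have -> : G t - G s - (t - s) * l = G t - t * l - (G s - s * l) by ring.
exact: mean_value_inequality_dist dGl gl.
Qed.

Lemma primitive_on_le S g G M (t : R) : primitive_on S g G -> `|t| <= S ->
  (forall r, `|r| <= S -> `|g r| <= M) -> `|G t| <= M * `|t|.
Proof.
move=> [G0 GE] tS gM; have S0 : `|0 : R| <= S by rewrite normr0 (le_trans _ tS).
have := GE 0 t 0 M S0 tS; rewrite G0 mulr0 !subr0; apply => r /(between S0 tS) rS.
by rewrite subr0 gM.
Qed.

Lemma Xinf_has_primitives p : has_primitives (Xinf R p).
Proof.
(* Primitives are taken on [-S, S] so that the endpoints of [-T, T] are interior. *)
move=> f T cf; pose S := `|T| + 1.
have S0 : 0 < S by rewrite ltr_wpDl.
have SS : - S <= S by lra.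
have inS (t : R) : t \in `[- S, S] = (`|t| <= S) by rewrite in_itv /= ler_norml.
have [x xS xmax] := norm_bounded_within SS (continuous_subspaceT cf).
pose M := `|f x|.
have part (phi : Rcomplex R -> R) : (forall z z', phi (z - z') = phi z - phi z') ->
    (forall z, `|phi z| <= `|z|) ->
    forall n, exists G, primitive_on S (fun t => phi (f t n)) G.
  move=> phiB phi1 n; apply: exists_primitive_on => s.
  apply/cvgrPdist_le => e e0; have /cvgrPdist_le/(_ e e0) := cf s.
  apply: filterS => t; apply: le_trans; rewrite -phiB (le_trans (phi1 _)) //.
  exact: (supnorm_ge (f s - f t)).
have [Gr GrP] := boolp.choice (part (@complex.Re R) (raddfB _) (@Re_le_norm R)).
have [Gi GiP] := boolp.choice (part (@complex.Im R) (raddfB _) (@Im_le_norm R)).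
have bound (phi : Rcomplex R -> R) (G : nat -> R -> R) : phi 0 = 0 ->
    (forall z, `|phi z| <= `|z|) ->
    (forall n, primitive_on S (fun t => phi (f t n)) (G n)) ->
    forall n (t : R), `|t| <= S -> `|G n t| <= M * `|t| /\ ((n < p)%N -> G n t = 0).
  move=> phi0 phi1 GP n t tS; split=> [|np].
    apply: primitive_on_le (GP n) tS _ => r rS.
    rewrite (le_trans (phi1 _)) // (le_trans (supnorm_ge _ _)) //.
    by apply: xmax; rewrite inS.
  apply/eqP; rewrite -normr_le0 -(mul0r `|t|).
  apply: primitive_on_le (GP n) tS _ => r _.
  by have /asboolP[_ ->] := valP (f r); rewrite // phi0 normr0.
have {}boundr := bound _ _ (raddf0 _) (@Re_le_norm R) GrP.
have {bound}boundi := bound _ _ (raddf0 _) (@Im_le_norm R) GiP.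
have HU t : exists U : Xinf R p, `|t| <= S ->
    forall n, U n = Complex (Gr n t) (Gi n t).
  have [tS|] := pselect (`|t| <= S); last by exists 0.
  pose w n : Rcomplex R := Complex (Gr n t) (Gi n t).
  have wX : w \in @Xinf_set R p.
    apply/asboolP; split; last first.
      by move=> n np; rewrite /w (boundr n t tS).2 // (boundi n t tS).2.
    apply/bounded_seqP; exists (M * `|t| + M * `|t|) => n.
    rewrite (le_trans (norm_le_ReIm _)) // lerD //.
      exact: (boundr n t tS).1.
    exact: (boundi n t tS).1.
  by exists (MkXinf wX).
have [G GE] := boolp.choice HU.
exists G => t tT; apply/is_deriveP => e e0.
have /cvgrPdist_le/(_ (e / 2)) := cf t; rewrite divr_gt0 // => /(_ isT).
move=> /nbhs_ballP[d /= d0 fd].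
exists (Num.min d 1); first by rewrite lt_min d0 ltr01.
move=> s; rewrite lt_min => /andP[sd s1].
have tS : `|t| <= S by rewrite (le_trans tT) // (le_trans (ler_norm T)) // lerDl.
have sS : `|s| <= S.
  have := ler_normD (s - t) t; rewrite subrK; have := ler_norm T.
  by move: tT s1; rewrite /S; lra.
have fr r : r \in `[Num.min t s, Num.max t s] -> forall n, `|f r n - f t n| <= e / 2.
  move=> rts n; rewrite distrC; apply: le_trans (supnorm_ge (f t - f r) n) _.
  apply: fd; rewrite -ball_normE /= distrC (le_lt_trans _ sd) //.
  move: rts; rewrite in_itv /=; case: (leP t s) => ts /andP[h1 h2].
    by rewrite !ger0_norm ?subr_ge0 // lerD2r.
  by rewrite !ler0_norm ?subr_le0 ?(ltW ts) // lerN2 lerD2r.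
apply: supnorm_le => n.
rewrite (le_trans (norm_le_ReIm _)) //.
have -> : e = e / 2 + e / 2 by lra.
have E : (G s - G t - (s - t) *: f t) n = G s n - G t n - (s - t) *: f t n by [].
rewrite mulrDl lerD //.
  have -> : complex.Re ((G s - G t - (s - t) *: f t) n) =
      Gr n s - Gr n t - (s - t) * complex.Re (f t n).
    by rewrite E !raddfB !GE //=; congr (_ - _); case: (f t n).
  apply: (GrP n).2 => // r rts.
  by rewrite -raddfB (le_trans (Re_le_norm _)) // fr.
have -> : complex.Im ((G s - G t - (s - t) *: f t) n) =
    Gi n s - Gi n t - (s - t) * complex.Im (f t n).
  by rewrite E !raddfB !GE //=; congr (_ - _); case: (f t n).
apply: (GiP n).2 => // r rts.
by rewrite -raddfB (le_trans (Im_le_norm _)) // fr.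
Qed.

End Primitives.

(** * The vector field and its solutions *)

Section VectorField.
Variables (R : realType) (p q l : nat).
Hypothesis hp : (1 <= p)%N.
Local Notation C := (Rcomplex R).
Implicit Types (u v : Xinf R p) (c : int -> C).

Definition lax_field c : int -> C :=
  c * (varrho p q l c - shift (- p%:Z) (varrho p q l c)).

Lemma lax_fieldE c h :
  lax_field c h = c h * (varrho p q l c h - varrho p q l c (h - p%:Z)).
Proof. by []. Qed.

Lemma lax_field_eq0 c h : c h = 0 -> lax_field c h = 0.
Proof. by rewrite lax_fieldE => ->; rewrite mul0r. Qed.

Lemma norm_zext_le u h : `|zext u h : C| <= `|u|.
Proof. by case: h => n /=; [exact: supnorm_ge|rewrite normr0]. Qed.

Lemma lax_field_mem u : (fun n : nat => lax_field (zext u) n) \in @Xinf_set R p.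
Proof.
apply/asboolP; split; last first.
  move=> n np; apply: lax_field_eq0 => /=.
  by have /asboolP[_ ->] := valP u.
have [B B0 HB] := @LopX_bounded R p q ((p + q) * l) `|u| (normr_ge0 u).
have rho h := HB (zext u) (norm_zext_le u) 0 h.
apply/bounded_seqP; exists (`|u| * (B + B)) => n.
rewrite lax_fieldE Rcomplex_normM ler_pM ?norm_zext_le //.
by rewrite (le_trans (ler_normB _ _)) // lerD ?rho.
Qed.

Definition Xinf_field u : Xinf R p := MkXinf (lax_field_mem u).

Lemma zext_field u : zext (Xinf_field u) = lax_field (zext u).
Proof. by apply/funext => -[n|n] //=; rewrite lax_field_eq0. Qed.

Lemma norm_field_sub_le (a a' x y x' y' : C) (N B K d : R) :
  `|a - a'| <= d -> `|a'| <= N -> `|x| <= B -> `|y| <= B ->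
  `|x - x'| <= K * d -> `|y - y'| <= K * d ->
  `|a * (x - y) - a' * (x' - y') : C| <= (B + B + N * (K + K)) * d.
Proof.
move=> aa aN xB yB xx yy.
have -> : a * (x - y) - a' * (x' - y') =
    (a - a') * (x - y) + a' * ((x - x') - (y - y')) by ring.
rewrite (le_trans (ler_normD _ _)) // !Rcomplex_normM mulrDl lerD //.
  by rewrite mulrC ler_pM // (le_trans (ler_normB _ _)) // lerD.
by rewrite -mulrA ler_pM // (le_trans (ler_normB _ _)) // mulrDl lerD.
Qed.

(** All coefficients of the powers of L have a common bound and a common Lipschitz
    constant when c stays in a ball, so the estimate is uniform in h. *)
Lemma Xinf_field_lipschitz : lipschitz_on_balls Xinf_field.
Proof.
move=> N; pose N' := Num.max N 0.
have N0 : 0 <= N' by rewrite le_max lexx orbT.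
have [B B0 HB] := @LopX_bounded R p q ((p + q) * l) N' N0.
have [K K0 HK] := @LopX_lipschitz R p q ((p + q) * l) N' N0.
exists (B + B + N' * (K + K)); first by rewrite !addr_ge0 ?mulr_ge0 ?addr_ge0.
move=> u v uN vN.
have zN (w : Xinf R p) : `|w| <= N -> forall h, `|zext w h : C| <= N'.
  by move=> wN h; apply: le_trans (norm_zext_le _ _) _; rewrite le_max wN.
have zB h : `|zext u h - zext v h : C| <= `|u - v|.
  case: h => n /=; last by rewrite subrr normr0.
  exact: (supnorm_ge (u - v)).
have rhoB h : `|varrho p q l (zext u) h : C| <= B := HB _ (zN u uN) 0 h.
have rhoK h : `|varrho p q l (zext u) h - varrho p q l (zext v) h : C| <=
    K * `|u - v| := HK _ _ _ (zN u uN) (zN v vN) zB 0 h.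
apply: supnorm_le => n.
have -> : (Xinf_field u - Xinf_field v) n =
  lax_field (zext u) n - lax_field (zext v) n by [].
exact: (norm_field_sub_le (zB n) (zN v vN n) (rhoB n) (rhoB (n%:Z - p%:Z))
  (rhoK n) (rhoK (n%:Z - p%:Z))).
Qed.

Lemma is_derive_zext (U : R -> Xinf R p) (t : R) u h : is_derive t 1 U u ->
  is_derive t 1 (fun s => zext (U s) h : C) (zext u h).
Proof.
case: h => n; last by move=> _; exact: is_derive_cst.
move=> /is_deriveP Uu; apply/is_deriveP => e /Uu[d d0 dU]; exists d => // s sd.
exact: le_trans (supnorm_ge (U s - U t - (s - t) *: u) n) (dU s sd).
Qed.

Lemma opp_p_eq_q : (- p%:Z == q%:Z) = false.
Proof. by apply/negbTE; lia. Qed.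

Lemma ode_lax_solution (I : set R) (U : R -> Xinf R p) :
  ode_solution Xinf_field I U -> lax_solution p q l I (fun t => zext (U t)).
Proof.
move=> UF t It j h; rewrite lax_rhsE // dcoef_dmon.
under eq_fun do rewrite dcoef_Lop //.
have [->|jq] := eqVneq j q%:Z; first by rewrite opp_p_eq_q; exact: is_derive_cst.
rewrite eq_sym; case: eqVneq => _; last exact: is_derive_cst.
rewrite mulr1n -/(lax_field _) -zext_field.
exact/is_derive_zext/UF.
Qed.

Section LaxSolution.
Variables (I : set R) (c : R -> int -> C).
Hypotheses (Iint : is_interval I) (cL : lax_solution p q l I c).

Lemma lax_solution_derive (t : R) h : I t ->
  is_derive t 1 (fun s => c s h) (lax_field (c t) h).
Proof.
move=> /cL/(_ (- p%:Z) h); rewrite lax_rhsE // dcoef_dmon eqxx mulr1n.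
by under eq_fun do rewrite dcoef_Lop // opp_p_eq_q eqxx.
Qed.

Let sub_I (a b : R) : I a -> I b ->
  forall t, t \in `[Num.min a b, Num.max a b] -> I t.
Proof.
move=> Ia Ib t tab; apply: (Iint (x := Num.min a b) (y := Num.max a b)).
- by case: leP.
- by case: leP.
- by move: tab; rewrite in_itv.
Qed.

(** Along a solution c_h satisfies the scalar equation c_h' = a c_h, and a is
    bounded on segments because each c_k is continuous. *)
Lemma lax_field_le (a b : R) h : I a -> I b -> exists K, forall t,
  t \in `[Num.min a b, Num.max a b] -> `|lax_field (c t) h : C| <= K * `|c t h|.
Proof.
move=> Ia Ib; have ab : Num.min a b <= Num.max a b by rewrite le_max ge_min lexx.
have cN k : exists N, forall t, t \in `[Num.min a b, Num.max a b] -> `|c t k| <= N.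
  have dc (t : R) : t \in `[Num.min a b, Num.max a b] ->
      is_derive t 1 (fun s => c s k) (lax_field (c t) k).
    by move=> /(sub_I Ia Ib)/lax_solution_derive.
  have [x _ xmax] := norm_bounded_within ab (is_derive_within dc).
  by exists `|c x k|.
have rho k := @LopX_bounded_on R p q c _ _ ((p + q) * l) cN 0 k.
have [B1 HB1] := rho h; have [B2 HB2] := rho (h - p%:Z).
exists (B1 + B2) => t tab; rewrite lax_fieldE Rcomplex_normM mulrC ler_wpM2r //.
exact: le_trans (ler_normB _ _) (lerD (HB1 t tab) (HB2 t tab)).
Qed.

Lemma lax_solution_eq0 (t0 t : R) h : I t0 -> I t -> c t0 h = 0 -> c t h = 0.
Proof.
move=> It0 It c0; have [K HK] := lax_field_le h It0 It.
apply: (@gronwall0 R C (fun s => c s h) (fun s => lax_field (c s) h)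
  (Num.min t0 t) (Num.max t0 t) K t0) => //.
- by move=> s /(sub_I It0 It)/lax_solution_derive.
- by rewrite in_itv /= ge_min le_max lexx.
- by rewrite in_itv /= ge_min le_max lexx !orbT.
Qed.

(** A real coefficient that changes sign vanishes at some time, hence at all times. *)
Lemma lax_solution_Re_gt0 (t0 t : R) h : (forall s, I s -> complex.Im (c s h) = 0) ->
  I t0 -> I t -> 0 < complex.Re (c t0 h) -> 0 < complex.Re (c t h).
Proof.
move=> c_real It0 It c0; rewrite ltNge; apply/negP => ct.
have cRe s : I s -> c s h = 0 <-> complex.Re (c s h) = 0.
  move=> /c_real; case: (c s h) => x y /= ->.
  by split=> [[]|->].
pose l' := Num.min t0 t; pose r' := Num.max t0 t.
have lr : l' <= r' by rewrite le_max ge_min lexx.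
have Rec : {within `[l', r'], continuous (fun s => complex.Re (c s h))}.
  apply: (@is_derive_within R R _ (fun s => complex.Re (lax_field (c s) h))).
  move=> s /(sub_I It0 It)/(lax_solution_derive h) cs.
  exact: (is_derive_linear (@Re_le_norm R) cs).
have [s srl s0] : exists2 s, s \in `[l', r'] & complex.Re (c s h) = 0.
  apply: (IVT lr Rec); rewrite ge_min le_max /l' /r'.
  case: (leP t0 t) => _; first by rewrite ct (ltW c0) orbT.
  by rewrite ct (ltW c0) orbT.
have Is := sub_I It0 It srl.
have := lax_solution_eq0 Is It0 ((cRe s Is).2 s0).
by move=> /(cRe t0 It0); move: c0 => /[swap] ->; rewrite ltxx.
Qed.

End LaxSolution.

End VectorField.

(** * The theorem *)

Unset Implicit Arguments.
Set Strict Implicit.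

Theorem theorem9p1 (R : realType) (p q : nat)
    (hp : (1 <= p)%N) (hq : (1 <= q)%N) :
  (* the bracket has only an S^(-p) term, and vanishes below the boundary *)
  (forall (l : nat) (c : int -> Rcomplex R), (1 <= l)%N ->
     (forall h : int, h < p%:Z -> c h = 0) ->
     exists2 d : int -> Rcomplex R,
       lax_rhs p q l c = dmon d (- p%:Z)
     & forall h : int, h < p%:Z -> d h = 0) /\
  (* the formal flows: existence, uniqueness, explicit form, commutation *)
  (exists D : nat -> cpoly R -> cpoly R,
     (forall l : nat, (1 <= l)%N ->
        [/\ formal_flow p q l (D l),
            forall D' : cpoly R -> cpoly R, formal_flow p q l D' -> D' =1 D l
          & forall h : int, D l (cvar R p h) =
              cvar R p h * (varrho p q l (cvar R p) h
                            - varrho p q l (cvar R p) (h - p%:Z))]) /\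
     (forall (l m : nat) (f : cpoly R), (1 <= l)%N -> (1 <= m)%N ->
        D l (D m f) = D m (D l f))) /\
  (* the flows on the Banach space *)
  (forall l : nat, (1 <= l)%N ->
     exists F : Xinf R p -> Xinf R p,
       [/\ forall u : Xinf R p,
             lax_rhs p q l (zext u) = dmon (zext (F u)) (- p%:Z),
           locally_lipschitz F,
           forall u0 : Xinf R p,
             exists (r T : R) (Phi : R -> Xinf R p -> Xinf R p),
               [/\ 0 < r, 0 < T & unique_local_C1_flow F u0 r T Phi]
         & forall (I : set R) (u : R -> Xinf R p), open I -> is_interval I ->
             ode_solution F I u ->
             lax_solution p q l I (fun t => zext (u t))]) /\
  (* explicit form, boundary values and positivity along any solution *)
  (forall (l : nat) (I : set R) (c : R -> int -> Rcomplex R), (1 <= l)%N ->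
     open I -> is_interval I -> lax_solution p q l I c ->
     [/\ forall (t : R) (h : int), I t ->
           is_derive t 1 (fun s => c s h)
             (c t h * (varrho p q l (c t) h - varrho p q l (c t) (h - p%:Z))),
         forall t0 : R, I t0 ->
           (forall h : int, h < p%:Z -> c t0 h = 0) ->
           forall (t : R) (h : int), I t -> h < p%:Z -> c t h = 0
       & (forall (t : R) (h : int), I t -> complex.Im (c t h) = 0) ->
         forall t0 : R, I t0 ->
           (forall h : int, h < p%:Z -> c t0 h = 0) ->
           (forall h : int, p%:Z <= h -> 0 < complex.Re (c t0 h)) ->
           forall (t : R) (h : int), I t -> p%:Z <= h ->
             0 < complex.Re (c t h)]).
Proof.
split; [|split; [|split]].
- move=> l c _ c0; exists (lax_field p q l c); first exact: lax_rhsE.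
  by move=> h /c0; exact: lax_field_eq0.
- have [D DF] := boolp.choice (exists_formal_flow R q hp).
  exists D; split=> [l _|l m f _ _]; last first.
    exact: (formal_flows_commute hp (DF l) (DF m)).
  have [dD DE] := (formal_flowE q hp l (D l)).1 (DF l).
  split=> // D' /(formal_flowE q hp)[dD' D'E].
  by apply: (derivation_ext (p := p)) => // h; rewrite D'E DE.
- move=> l _; exists (@Xinf_field R p q l).
  have Flip := @Xinf_field_lipschitz R p q l.
  split.
  + by move=> u; rewrite zext_field; exact: lax_rhsE.
  + exact: lipschitz_on_balls_locally.
  + exact: local_flow_exists Flip (@Xinf_has_primitives R p).
  + by move=> I u _ _; exact: ode_lax_solution.
- move=> l I c _ _ Iint cL; split.
  + by move=> t h; exact: (lax_solution_derive hp cL).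
  + move=> t0 It0 c0 t h It /c0.
    exact: (lax_solution_eq0 hp Iint cL It0 It).
  + move=> c_real t0 It0 _ c0 t h It /c0.
    by apply: (lax_solution_Re_gt0 hp Iint cL) => // s; exact: c_real.
Qed.
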